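(* Let $(X_n)_{n\in\mathbb{N}}$ be a random sequence in $\mathbb{R}^d$, adapted to a filtration $(\mathcal{F}_n)_{n\in\mathbb{N}}$, such that for all $n\ge0$ $$X_{n+1}-X_n=\gamma_{n+1}G_n+c_{n+1}(\varepsilon_{n+1}+r_{n+1}),$$ with $\gamma,c,G,\varepsilon,r$ as in the context. Let $\Gamma$ be an event. Suppose that $\gamma_n=O(c_n)$, that $r=r'+r''$ where $r'$ is adapted and $r''$ is predictable, and that there are a finite random variable $T_0$, $a>2$, $\beta>0$, $\rho>0$ and $\nu>\frac12$ such that, almost surely on $\Gamma$, \begin{itemize} \item $0<\liminf_{n\to\infty}\mathbb{E}[\|\varepsilon_n\|^2|\mathcal{F}_{n-1}]$ and $\limsup_{n\to\infty}\mathbb{E}[\|\varepsilon_n\|^a|\mathcal{F}_{n-1}]<\infty$; \item $\langle G_n,X_n\rangle\ge\beta\|X_n\|^2$ for all $n\ge T_0$ such that $\|X_n\|<\rho$; \item $\sum_n\|r'_n\|^2<\infty$ and $r''_n=O\left(\frac{\gamma_n^{1+\nu}}{c_n}\right)$. \end{itemize} Then $\mathbb{P}\big[\Gamma\cap\{\lim_{n\to\infty}X_n=0\}\big]=0$.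
   Context: $\langle\cdot,\cdot\rangle$ is an inner product on $\mathbb{R}^d$ with norm $\|\cdot\|$. $(\gamma_n)_{n\ge0}$ and $(c_n)_{n\ge0}$ are non-negative deterministic sequences with $c_n\ne0$ infinitely often and $\sum_nc_n^2<\infty$. $(\varepsilon_n)_{n\ge0}$, $(r_n)_{n\ge0}$ and $(G_n)_{n\ge0}$ are $\mathbb{R}^d$-valued sequences adapted to $(\mathcal{F}_n)$ such that for all $n\ge0$, $\mathbb{E}[\varepsilon_{n+1}|\mathcal{F}_n]=0$ and $\mathbb{E}[\|\varepsilon_{n+1}\|^2|\mathcal{F}_n]<\infty$. Predictable means that $r''_{n+1}$ is $\mathcal{F}_n$-measurable for all $n\ge 0$. Convention: $\frac00=1$ and $\frac b0=\infty$ for $b>0$. *)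

(* Defs.v *)
(* World: MathComp / MathComp-Analysis. *)
From HB Require Import structures.
From mathcomp Require Import all_boot all_order all_algebra.
From mathcomp Require Import all_classical all_reals all_analysis.
From mathcomp Require Import measurable_realfun.

Set Implicit Arguments.
Unset Strict Implicit.
Unset Printing Implicit Defensive.

Import Order.TTheory GRing.Theory Num.Theory.
Import numFieldNormedType.Exports.

Local Open Scope classical_set_scope.
Local Open Scope ring_scope.

(* Not to be confused with the library norm `|x| on row vectors, which is the
   sup norm. *)
Definition dot_norm (R : realType) (d : nat)
    (ip : {dot 'rV[R]_d for (idfun : R -> R)}) (x : 'rV[R]_d) : R :=
  Num.sqrt (ip x x).

Definition borel_rV (R : realType) (d : nat) : set (set 'rV[R]_d) :=
  <<s @open 'rV[R]_d >>.

Definition measurable_wrt (T U : Type) (G : set (set T)) (H : set (set U))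
    (f : T -> U) : Prop :=
  forall B, H B -> G (f @^-1` B).

Definition filtration (disp : measure_display) (T : measurableType disp)
    (F : nat -> set (set T)) : Prop :=
  [/\ forall n, sigma_algebra setT (F n),
      forall n, F n `<=` measurable &
      forall m n, (m <= n)%N -> F m `<=` F n].

Definition adapted (R : realType) (d : nat) (T : Type)
    (F : nat -> set (set T)) (X : nat -> T -> 'rV[R]_d) : Prop :=
  forall n, measurable_wrt (F n) (@borel_rV R d) (X n).

(* No condition is put on the term of index 0. *)
Definition predictable (R : realType) (d : nat) (T : Type)
    (F : nat -> set (set T)) (X : nat -> T -> 'rV[R]_d) : Prop :=
  forall n, measurable_wrt (F n) (@borel_rV R d) (X n.+1).

(* [Y] is a version of E[Z | G] for a nonnegative, possibly non-integrable
   [Z]; the value +oo is allowed. *)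
Definition is_cond_exp_ge0 (R : realType) (disp : measure_display)
    (T : measurableType disp) (P : probability T R) (G : set (set T))
    (Z Y : T -> \bar R) : Prop :=
  [/\ forall w, (0 <= Y w)%E,
      measurable_wrt G (@measurable _ (\bar R : measurableType _)) Y &
      forall A, G A -> (\int[P]_(w in A) Y w = \int[P]_(w in A) Z w)%E].

(* [Y] is a version of E[Z | G] = E[Z^+ | G] - E[Z^- | G], which makes sense
   as soon as both terms are almost surely finite: [Z] need not be
   integrable. *)
Definition is_cond_exp (R : realType) (disp : measure_display)
    (T : measurableType disp) (P : probability T R) (G : set (set T))
    (Z Y : T -> R) : Prop :=
  measurable_wrt G (@measurable _ (R : measurableType _)) Y /\
  exists Yp Yn : T -> \bar R,
    [/\ is_cond_exp_ge0 P G (EFin \o Z^\+) Yp,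
        is_cond_exp_ge0 P G (EFin \o Z^\-) Yn &
        {ae P, forall w, [/\ (Yp w < +oo)%E, (Yn w < +oo)%E &
                             ((Y w)%:E = Yp w - Yn w)%E]}].

Definition is_cond_exp_rV (R : realType) (d : nat) (disp : measure_display)
    (T : measurableType disp) (P : probability T R) (G : set (set T))
    (Z Y : T -> 'rV[R]_d) : Prop :=
  forall i, is_cond_exp P G (fun w => Z w ord0 i) (fun w => Y w ord0 i).

(* The quotient b / c of nonnegative reals, with 0 / 0 = 1 and b / 0 = +oo
   for b > 0. *)
Definition ediv (R : realType) (b c : R) : \bar R :=
  if c == 0 then (if b == 0 then 1%E else +oo%E) else (b / c)%:E.

(* Main.v *)
(* Write [r' = r1], [r'' = r2] and put
   [Y_k = X_k + gamma_{k+1} G_k + c_{k+1} r''_{k+1}]. This is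
   [F_k]-measurable and, the outward drift absorbing the predictable remainder,
   [|Y_k|^2 >= |X_k|^2 - s_{k+1}] with
   [s_k = O(gamma_k^(1+2 nu)) = o(c_k^2)]; moreover
   [X_{k+1} = Y_k + c_{k+1} (eps_{k+1} + r'_{k+1})]. Let [a2_k] be the tail sum
   of [c_i^2] over [i > k].

   If [|Y_k| >= K sqrt a2_k], then, by convexity of the norm, [|X|] dominates
   afterwards a process whose noise has variance [O(a2_k)], so the conditional
   probability that [X] still tends to [0] is [O(1/K)]. On the other hand
   [|Y_k| < K sqrt a2_k] cannot hold for all large [k] with positive
   probability: up to the exit time [|X|^2] gains in the mean at least a fixed
   multiple of [c_{k+1}^2] at each step, hence a fixed multiple of [a2_n] from
   time [n] on, whereas what is left at the exit is [o(a2_n)], since the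
   probability of an exit after [n] vanishes and the bound on moments of order
   [a > 2] makes the [|eps_k|^2] uniformly integrable. So [X -> 0] has
   probability [O(1/K)] for all [K].

   The almost sure conditions are first cut down to events on which they hold
   with deterministic constants from a deterministic time on. *)
Require Import Defs.
From HB Require Import structures.
From mathcomp Require Import all_boot all_order all_algebra.
From mathcomp Require Import all_classical all_reals all_analysis.
From mathcomp Require Import measurable_realfun.
From mathcomp Require Import ring lra zify.

Set Implicit Arguments.
Unset Strict Implicit.

Import Order.TTheory GRing.Theory Num.Theory.
Import numFieldNormedType.Exports.

Local Open Scope classical_set_scope.
Local Open Scope ring_scope.

Section DotProduct.
Context {R : realType} {d : nat} (ip : {dot 'rV[R]_d for (idfun : R -> R)}).
Implicit Types (x y z : 'rV[R]_d) (t : R).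

Lemma ipC x y : ip x y = ip y x.
Proof. by rewrite (@hermitian_subproof _ _ _ _ ip) expr0 mul1r. Qed.

Lemma ipDr x y z : ip x (y + z) = ip x y + ip x z.
Proof. exact: linearDr. Qed.

Lemma ipDl x y z : ip (x + y) z = ip x z + ip y z.
Proof. by rewrite ipC ipDr !(ipC z). Qed.

Lemma ipZr t x y : ip x (t *: y) = t * ip x y.
Proof. exact: linearZr_LR. Qed.

Lemma ipZl t x y : ip (t *: x) y = t * ip x y.
Proof. by rewrite ipC ipZr ipC. Qed.

Lemma ipNr x y : ip x (- y) = - ip x y.
Proof. by rewrite -scaleN1r ipZr mulN1r. Qed.

Lemma ipNl x y : ip (- x) y = - ip x y.
Proof. by rewrite ipC ipNr ipC. Qed.

Lemma ip0r x : ip x 0 = 0.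
Proof. by rewrite -(scale0r 0) ipZr mul0r. Qed.

Lemma ip_ge0 x : 0 <= ip x x.
Proof.
have [->|/(@neq0_dnorm_gt0 _ _ _ ip)/ltW//] := eqVneq x 0; by rewrite ip0r.
Qed.

Lemma ip_eq0 x : ip x x = 0 -> x = 0.
Proof.
by move=> x0; apply/eqP; apply: contraT => /(@neq0_dnorm_gt0 _ _ _ ip); rewrite x0 ltxx.
Qed.

Lemma ipDD x y : ip (x + y) (x + y) = ip x x + 2 * ip x y + ip y y.
Proof. by rewrite ipDr !ipDl (ipC y x); ring. Qed.

Lemma ip_young t x y : 0 < t -> 2 * ip x y <= t * ip x x + ip y y / t.
Proof.
move=> t0; have := ip_ge0 (t *: x - y).
rewrite ipDD !(ipNr, ipNl, ipZl, ipZr) => H.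
rewrite -(ler_pM2l t0) mulrDr mulrCA (mulrC t (_ / t)) divfK ?gt_eqF//.
by nra.
Qed.

Lemma ip_cauchy_schwarz x y : ip x y ^+ 2 <= ip x x * ip y y.
Proof.
have [->|y0] := eqVneq y 0; first by rewrite !ip0r expr0n mulr0.
have {}y0 := @neq0_dnorm_gt0 _ _ _ ip _ y0.
have := ip_ge0 (ip y y *: x - ip x y *: y).
rewrite ipDD !(ipNr, ipNl, ipZl, ipZr) => H.
rewrite -(ler_pM2l y0); nra.
Qed.

Lemma dot_norm_sq x : dot_norm ip x ^+ 2 = ip x x.
Proof. by rewrite sqr_sqrtr// ip_ge0. Qed.

Lemma dot_norm_ge0 x : 0 <= dot_norm ip x.
Proof. exact: sqrtr_ge0. Qed.

Lemma ip_sum x y : ip x y = \sum_i y ord0 i * ip x (delta_mx ord0 i).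
Proof.
rewrite {1}(row_sum_delta y) linear_sumr/=.
by apply: eq_bigr => i _; rewrite ipZr.
Qed.

Lemma ip_coord_bound : exists2 B, 0 <= B &
  forall x i, `|x ord0 i| <= B * dot_norm ip x.
Proof.
pose Gram : 'M[R]_d := \matrix_(i, j) ip (delta_mx ord0 i) (delta_mx ord0 j).
have GramE x i : (x *m Gram) ord0 i = ip x (delta_mx ord0 i).
  rewrite mxE ipC ip_sum; apply: eq_bigr => j _.
  by rewrite mxE ipC.
have Gu : Gram \in unitmx.
  rewrite -row_free_unit; apply/inj_row_free => x xG; apply: ip_eq0.
  by rewrite ip_sum big1// => i _; rewrite -GramE xG mxE mulr0.
pose dual i : 'rV[R]_d := row i (invmx Gram)^T.
have dualE x i : x ord0 i = ip x (dual i).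
  rewrite ip_sum -[in LHS](mulmxK Gu x) mxE.
  by apply: eq_bigr => j _; rewrite GramE !mxE mulrC.
exists (\sum_i dot_norm ip (dual i)); first by apply: sumr_ge0 => i _; exact: dot_norm_ge0.
move=> x i; rewrite dualE.
apply: (@le_trans _ _ (dot_norm ip (dual i) * dot_norm ip x)).
  rewrite -(@ler_pXn2r _ 2) ?nnegrE ?mulr_ge0 ?dot_norm_ge0//.
  rewrite real_normK ?num_real// exprMn !dot_norm_sq mulrC.
  exact: ip_cauchy_schwarz.
apply: ler_wpM2r; first exact: dot_norm_ge0.
rewrite (bigD1 i)//= lerDl; by apply: sumr_ge0 => j _; exact: dot_norm_ge0.
Qed.

End DotProduct.

Section VectorMeasurability.
Context {R : realType} {d : nat} {disp : measure_display}
  {T : measurableType disp}.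
Implicit Types (X Y : T -> 'rV[R]_d) (f : T -> R).

Definition coord_mfun X :=
  forall i, measurable_fun setT (fun w => X w ord0 i).

Lemma coord_mfunD X Y :
  coord_mfun X -> coord_mfun Y -> coord_mfun (fun w => X w + Y w).
Proof.
move=> mX mY i; under eq_fun do rewrite mxE.
exact: measurable_funD.
Qed.

Lemma coord_mfunZ f X : measurable_fun setT f ->
  coord_mfun X -> coord_mfun (fun w => f w *: X w).
Proof.
move=> mf mX i; under eq_fun do rewrite mxE.
exact: measurable_funM.
Qed.

Lemma measurable_ip (ip : {dot 'rV[R]_d for (idfun : R -> R)}) X Y :
  coord_mfun X -> coord_mfun Y -> measurable_fun setT (fun w => ip (X w) (Y w)).
Proof.
move=> mX mY.
have -> : (fun w => ip (X w) (Y w)) = (fun w => \sum_i Y w ord0 i *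
    (\sum_j X w ord0 j * ip (delta_mx ord0 i) (delta_mx ord0 j))).
  by apply/funext => w; rewrite (ip_sum ip); apply: eq_bigr => i _; rewrite ipC -ip_sum.
apply: measurable_sum => i; apply: measurable_funM => //.
apply: measurable_sum => j; apply: measurable_funM => //.
Qed.

End VectorMeasurability.

Section SubSigmaAlgebra.
Context {R : realType} {disp : measure_display} {T : measurableType disp}.
Implicit Types (S : set (set T)).

Lemma measurable_fun_sub S d' (U : measurableType d') (f : T -> U) :
  S `<=` measurable ->
  measurable_fun setT (f : g_sigma_algebraType S -> U) -> measurable_fun setT f.
Proof.
move=> SM mf _ B mB; have := mf measurableT B mB.
apply: smallest_sub => //; exact: sigma_algebra_measurable.
Qed.

Lemma measurable_fun_subS S1 S2 d' (U : measurableType d') (f : T -> U) :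
  S1 `<=` S2 ->
  measurable_fun setT (f : g_sigma_algebraType S1 -> U) ->
  measurable_fun setT (f : g_sigma_algebraType S2 -> U).
Proof.
move=> S12 mf _ B mB; have := mf measurableT B mB.
exact: sub_sigma_algebra2.
Qed.

Lemma measurable_sub S (A : set T) : sigma_algebra setT S ->
  S A = measurable (A : set (g_sigma_algebraType S)).
Proof. by move=> /measurable_g_measurableTypeE ->. Qed.

Lemma measurable_wrt_fun S d' (U : measurableType d') (f : T -> U) :
  measurable_wrt S measurable f ->
  measurable_fun setT (f : g_sigma_algebraType S -> U).
Proof.
by move=> mf _ B mB; rewrite setTI; apply: sub_sigma_algebra; exact: mf.
Qed.

Lemma borel_coord_mfun S d (X : T -> 'rV[R]_d) :
  measurable_wrt S (@borel_rV R d) X ->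
  coord_mfun (X : g_sigma_algebraType S -> 'rV[R]_d).
Proof.
move=> mX i; apply: measurable_wrt_fun => B mB.
apply: (mX [set x | B (x ord0 i)]).
have : (fun x : 'rV[R]_d => x ord0 i) @^-1` B = [set x | B (x ord0 i)] by [].
move=> <-.
have mc : measurable_fun setT ((fun x => x ord0 i) : g_sigma_algebraType (@open 'rV[R]_d) -> R).
  apply: (measurability (@RGenOpens.G R)).
    exact: RGenOpens.measurableE.
  move=> _ [_ [a [b ->]] <-]; rewrite setTI; apply: sub_sigma_algebra.
  apply: open_comp; last exact: interval_open.
  move=> x _; exact: coord_continuous.
by have := mc measurableT B mB; rewrite setTI.
Qed.

End SubSigmaAlgebra.

Section Orthogonality.
Context {R : realType} {disp : measure_display} {T : measurableType disp}
  (P : probability T R) (S : set (set T)).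
Hypotheses (SA : sigma_algebra setT S) (SM : S `<=` measurable).

(* With [s] the sign of [f], the function [2 f - s] is again bounded by [1] and
   has twice the integral against [g], so this integral must vanish. *)
Lemma orthogonal_bounded1 (H : set T) (f g : T -> R) : S H ->
  P.-integrable H (EFin \o g) ->
  (forall A, S A -> A `<=` H -> \int[P]_(w in A) g w = 0) ->
  measurable_fun setT (f : g_sigma_algebraType S -> R) ->
  (forall w, `|f w| <= 1) ->
  \int[P]_(w in H) (f w * g w) = 0.
Proof.
move=> SH ig g0 mf f1.
have mH : measurable H by exact: SM.
have ifg (h : T -> R) : measurable_fun setT (h : g_sigma_algebraType S -> R) ->
    (forall w, `|h w| <= 1) -> P.-integrable H (EFin \o (fun w => h w * g w)).
  move=> mh h1; apply: le_integrable (integrable_norm ig) => //.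
    apply/measurable_EFinP/measurable_funM.
      by apply: measurable_funTS; exact: (measurable_fun_sub SM mh).
    by apply/measurable_EFinP; exact: measurable_int ig.
  move=> w Hw /=; rewrite lee_fin normr_id normrM ler_piMl//.
have bnd n : forall h : T -> R, measurable_fun setT (h : g_sigma_algebraType S -> R) ->
    (forall w, `|h w| <= 1) ->
    `|\int[P]_(w in H) (h w * g w)| <= 2 ^- n * \int[P]_(w in H) `|g w|.
  elim: n => [|n IH] h mh h1.
    rewrite expr0 invr1 mul1r.
    apply: le_trans (le_normr_Rintegral mH (ifg h mh h1)) _.
    apply: le_Rintegral => //.
    - exact: integrable_norm (ifg h mh h1).
    - exact: integrable_norm.
    - by move=> w Hw; rewrite normrM ler_piMl.
  pose E := [set w | 0 <= h w].
  have SE : S E.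
    have := mh measurableT `[0, +oo[%classic (measurable_itv _).
    rewrite setTI (_ : h @^-1` _ = E); last first.
      by apply/seteqP; split => w /=; rewrite in_itv/= andbT.
    by move=> /(smallest_sub SA (fun _ => id)).
  pose s w : R := \1_E w - \1_(~` E) w.
  have s1 w : `|2 * h w - s w| <= 1.
    have := h1 w; rewrite /s !indicE in_setC !ler_norml => /andP[hl hu].
    have [hw|hw] := leP 0 (h w).
      by rewrite (mem_set (hw : E w))/=; apply/andP; split; lra.
    have /negbTE -> : w \notin E by apply/negP; rewrite inE /E/= leNgt hw.
    by apply/andP; split => /=; lra.
  have ms : measurable_fun setT (s : g_sigma_algebraType S -> R).
    apply: measurable_funB; apply: measurable_indic; rewrite -measurable_sub//.
    by rewrite measurable_sub//; apply: measurableC; rewrite -measurable_sub.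
  have sg0 : \int[P]_(w in H) (s w * g w) = 0.
    have mE : measurable E by exact: SM.
    have isg : P.-integrable H (EFin \o (fun w => s w * g w)).
      apply: ifg => // w; rewrite /s !indicE in_setC.
      by case: (w \in E); rewrite /= ?subr0 ?sub0r ?normrN normr1.
    have HE : H = (H `&` E) `|` (H `&` ~` E) by rewrite -setIUr setUv setIT.
    rewrite {1}HE Rintegral_setU -?HE//; last 3 first.
    - exact: measurableI.
    - by apply: measurableI => //; exact: measurableC.
    - by apply/disj_setPS => w [[_ ?] [_]].
    rewrite (@eq_Rintegral _ _ _ _ (H `&` E) g); last first.
      move=> w; rewrite inE => -[_ Ew]; rewrite /s !indicE in_setC mem_set//=.
      by rewrite subr0 mul1r.
    rewrite (@eq_Rintegral _ _ _ _ (H `&` ~` E) (fun w => (-1) * g w)); last first.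
      move=> w; rewrite inE => -[_ Ew]; rewrite /s !indicE in_setC memNset//=.
      by rewrite sub0r.
    rewrite RintegralZl; last 2 first.
    - by apply: measurableI => //; exact: measurableC.
    - apply: integrableS ig => //.
      by apply: measurableI => //; exact: measurableC.
    rewrite !g0 ?mulr0 ?addr0//; rewrite measurable_sub//.
    - by apply: measurableI; first (by rewrite -measurable_sub); apply: measurableC; rewrite -measurable_sub.
    - by apply: measurableI; rewrite -measurable_sub.
  have -> : \int[P]_(w in H) (h w * g w) =
      2^-1 * \int[P]_(w in H) ((2 * h w - s w) * g w).
    rewrite (@eq_Rintegral _ _ _ _ H
      (fun w => 2 * (h w * g w) - s w * g w)
      (fun w => (2 * h w - s w) * g w)); last first.
      by move=> w _; rewrite mulrBl mulrA.
    rewrite RintegralB//; last 2 first.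
    - exact: (integrableZl mH 2 (ifg h mh h1)).
    - apply: ifg => // w; rewrite /s !indicE in_setC.
      by case: (w \in E); rewrite /= ?subr0 ?sub0r ?normrN normr1.
    rewrite sg0 subr0 RintegralZl//; last exact: ifg.
    by rewrite mulrA mulVf// mul1r.
  rewrite normrM ger0_norm ?invr_ge0// exprS invfM -mulrA ler_pM2l ?invr_gt0//.
  apply: IH => //; apply: measurable_funB => //; exact: measurable_funM.
set I := \int[P]_(w in H) (f w * g w) in bnd *.
set B := \int[P]_(w in H) `|g w| in bnd *.
have B0 : 0 <= B by apply: Rintegral_ge0 => w _.
apply/eqP; rewrite -normr_le0 leNgt; apply/negP => I0.
have BI : B / `|I| < (2 ^ Num.bound (B / `|I|))%:R.
  apply: lt_trans (archi_boundP _) _; first by rewrite divr_ge0.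
  by rewrite ltr_nat ltn_expl.
have := bnd (Num.bound (B / `|I|)) f mf f1.
move: BI; rewrite natrX ltr_pdivrMr// -ltr_pdivrMl ?exprn_gt0// => BI.
by rewrite leNgt BI.
Qed.

End Orthogonality.

Section ConditionalMeanZero.
Context {R : realType} {disp : measure_display} {T : measurableType disp}
  (P : probability T R) (S : set (set T)).
Hypotheses (SA : sigma_algebra setT S) (SM : S `<=` measurable).

Lemma cond_exp0_integral (g : T -> R) (A : set T) :
  is_cond_exp P S g (cst 0) -> S A -> P.-integrable A (EFin \o g) ->
  \int[P]_(w in A) g w = 0.
Proof.
move=> [_ [Yp [Yn [[Yp0 mYp gp] [Yn0 mYn gn] Y]]]] SA' ig.
have mA : measurable A by exact: SM.
have E : (\int[P]_(w in A) Yp w = \int[P]_(w in A) Yn w)%E.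
  apply: ge0_ae_eq_integral => //.
  - apply: measurable_funTS; exact: (measurable_fun_sub SM (measurable_wrt_fun mYp)).
  - apply: measurable_funTS; exact: (measurable_fun_sub SM (measurable_wrt_fun mYn)).
  - apply: filterS Y => w [Ypoo Ynoo +] _ /=.
    case: (Yp w) (Yp0 w) Ypoo => [p||]//; case: (Yn w) (Yn0 w) Ynoo => [n||]// _ _ _ _.
    by move=> /= -[] /eqP; rewrite eq_sym subr_eq0 => /eqP ->.
rewrite /Rintegral -[fun w => (g w)%:E]/(EFin \o g) integralE funerpos funerneg.
by rewrite -gp// -gn// E; case: (\int[P]_(w in A) Yn w)%E => //= x; rewrite subrr.
Qed.

Context {d : nat} (ip : {dot 'rV[R]_d for (idfun : R -> R)}).

Lemma integrable_ip_orthogonal (H : set T) (y e : T -> 'rV[R]_d) (B : R) :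
  S H -> coord_mfun (y : g_sigma_algebraType S -> 'rV[R]_d) -> coord_mfun e ->
  is_cond_exp_rV P S e (cst 0) ->
  P.-integrable H (fun w => (ip (e w) (e w))%:E) ->
  (forall w, H w -> ip (y w) (y w) <= B) ->
  P.-integrable H (fun w => (ip (y w) (e w))%:E) /\
  \int[P]_(w in H) ip (y w) (e w) = 0.
Proof.
move=> SH my me e0 ie yB.
have mH : measurable H by exact: SM.
have [K K0 eK] := ip_coord_bound ip.
have i1 : P.-integrable H (EFin \o cst 1) by exact: finite_measure_integrable_cst.
have nle x : dot_norm ip x <= 1 + ip x x.
  rewrite -dot_norm_sq; have := sqr_ge0 (dot_norm ip x - 1/2); nra.
have iei i : P.-integrable H (fun w => (e w ord0 i)%:E).
  apply: (@le_integrable _ _ _ _ _ mH _ (fun w => (K * (1 + ip (e w) (e w)))%:E)).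
  - by apply/measurable_EFinP; apply: measurable_funTS; exact: me.
  - move=> w Hw; rewrite !abse_EFin lee_fin.
    apply: le_trans (eK _ _) _; apply: le_trans (ler_norm _); apply: ler_wpM2l => //; exact: nle.
  - exact: (integrableZl mH K (integrableD mH i1 ie)).
pose f i w : R := \1_H w * ip (y w) (delta_mx ord0 i).
pose D i : R := 1 + `|B| * ip (delta_mx ord0 i) (delta_mx ord0 i : 'rV[R]_d).
have D1 i : 1 <= D i by rewrite lerDl mulr_ge0 ?ip_ge0.
have fD i w : `|(D i)^-1 * f i w| <= 1.
  have D0 : 0 < D i := lt_le_trans ltr01 (D1 i).
  rewrite normrM normfV (gtr0_norm D0) ler_pdivrMl// mulr1 /f indicE.
  case: (boolP (w \in H)) => [|_]; last by rewrite mul0r normr0 ltW.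
  rewrite inE mul1r => /yB yB'; set u := delta_mx _ _.
  have le1 (a : R) : `|a| <= 1 + a ^+ 2.
    by rewrite -real_normK ?num_real//; have := sqr_ge0 (`|a| - 1/2); nra.
  apply: le_trans (le1 _) _; rewrite lerD2l.
  apply: le_trans (ip_cauchy_schwarz _ _ _) _.
  by apply: ler_wpM2r; [exact: ip_ge0|exact: le_trans yB' (ler_norm _)].
have mf i : measurable_fun setT ((fun w => (D i)^-1 * f i w) : g_sigma_algebraType S -> R).
  apply: measurable_funM => //; apply: measurable_funM.
    by apply: measurable_indic; rewrite -measurable_sub.
  by apply: measurable_ip => // j; exact: measurable_cst.
have ipE w : H w ->
    ip (y w) (e w) = \sum_i D i * ((D i)^-1 * f i w * e w ord0 i).
  move=> Hw; rewrite ip_sum; apply: eq_bigr => i _.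
  rewrite /f indicE mem_set// mul1r !mulrA divff ?mul1r; first by rewrite mulrC.
  by rewrite gt_eqF// (lt_le_trans ltr01).
have ifi i : P.-integrable H (EFin \o (fun w => (D i)^-1 * f i w * e w ord0 i)).
  apply: le_integrable (integrable_norm (iei i)) => //.
    apply/measurable_EFinP; apply: measurable_funTS; apply: measurable_funM.
      exact: (measurable_fun_sub SM (mf i)).
    exact: me.
  by move=> w Hw /=; rewrite lee_fin normr_id normrM ler_piMl.
have i0 i : \int[P]_(w in H) ((D i)^-1 * f i w * e w ord0 i) = 0.
  apply: (orthogonal_bounded1 SA SM SH (iei i)) => //.
  move=> A SA' AH; apply: cond_exp0_integral => //.
    have -> : cst 0 = (fun w => (cst 0 w : 'rV[R]_d) ord0 i) :> (T -> R).
      by apply/funext => w; rewrite mxE.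
    exact: e0.
  by apply: (integrableS mH _ AH (iei i)); exact: SM.
have isum (s : seq 'I_d) :
    P.-integrable H (EFin \o (fun w => \sum_(i <- s) D i * ((D i)^-1 * f i w * e w ord0 i))) /\
    \int[P]_(w in H) (\sum_(i <- s) D i * ((D i)^-1 * f i w * e w ord0 i)) = 0.
  elim: s => [|i s [IH1 IH2]].
    split; first by apply: eq_integrable (integrable0 P H) => // w _ /=; rewrite big_nil.
    under eq_Rintegral do rewrite big_nil.
    by rewrite Rintegral_cst// mul0r.
  have iDi : P.-integrable H (EFin \o (fun w => D i * ((D i)^-1 * f i w * e w ord0 i))).
    exact: (integrableZl mH (D i) (ifi i)).
  split.
    by apply: eq_integrable (integrableD mH iDi IH1) => // w _ /=; rewrite big_cons.
  under eq_Rintegral do rewrite big_cons.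
  by rewrite RintegralD// IH2 addr0 RintegralZl// i0 mulr0.
have [I1 I2] := isum (index_enum 'I_d); split.
  by apply: eq_integrable I1 => // w /[1!inE] Hw /=; rewrite ipE.
rewrite -[RHS]I2; apply: eq_Rintegral => w /[1!inE] Hw; exact: ipE.
Qed.
End ConditionalMeanZero.

Section DeterministicSteps.
Context {R : realType} {d : nat} (ip : {dot 'rV[R]_d for (idfun : R -> R)}).
Implicit Types (x y e q h : 'rV[R]_d) (t b c th K A : R).

Lemma sqr_maxr0_le (z u : R) : z <= u -> Num.max 0 z ^+ 2 <= u ^+ 2.
Proof.
move=> zu; case: (leP z 0) => z0; first by rewrite expr0n/= sqr_ge0.
by rewrite ler_pXn2r ?nnegrE//; [exact: ltW|exact: le_trans (ltW z0) zu].
Qed.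

Lemma ip_addsq_le e q : ip (e + q) (e + q) <= 2 * ip e e + 2 * ip q q.
Proof. by rewrite ipDD; have := ip_young ip e q ltr01; lra. Qed.

Lemma ip_normalized_le1 t y : 0 <= t ->
  ip ((Num.sqrt (t + ip y y))^-1 *: y) ((Num.sqrt (t + ip y y))^-1 *: y) <= 1.
Proof.
move=> t0; rewrite ipZl ipZr mulrA -expr2 exprVn.
have y0 := ip_ge0 ip y.
rewrite sqr_sqrtr ?addr_ge0//.
have [->|ty] := eqVneq (t + ip y y) 0; first by rewrite invr0 mul0r.
have {}ty : 0 < t + ip y y by rewrite lt_neqAle eq_sym ty addr_ge0.
by rewrite ler_pdivrMl// mulr1 lerDr.
Qed.

(* [x |-> sqrt (t + |x|^2)] is the norm of [(sqrt t, x)], hence convex, with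
   gradient [x / sqrt (t + |x|^2)]. *)
Lemma sqrt_ip_convex t y h : 0 <= t ->
  Num.sqrt (t + ip y y) + ip ((Num.sqrt (t + ip y y))^-1 *: y) h
    <= Num.sqrt (t + ip (y + h) (y + h)).
Proof.
move=> t0; have y0 := ip_ge0 ip y; have yh0 := ip_ge0 ip (y + h).
set r := Num.sqrt (t + ip y y).
have r0 : 0 <= r by exact: sqrtr_ge0.
have r2 : r ^+ 2 = t + ip y y by rewrite sqr_sqrtr// addr_ge0.
have [r00|rn0] := eqVneq r 0.
  rewrite r00 invr0 ipZl mul0r addr0; exact: sqrtr_ge0.
have [l0|l0] := leP (r + ip (r^-1 *: y) h) 0.
  exact: le_trans l0 (sqrtr_ge0 _).
rewrite -(@ler_pXn2r _ 2) ?nnegrE ?sqrtr_ge0//; last exact: ltW.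
rewrite sqr_sqrtr ?addr_ge0// sqrrD r2 ipDD ipZl.
have -> : r * (r^-1 * ip y h) *+ 2 = 2 * ip y h.
  by rewrite mulrA divff// mul1r mulr_natl.
suff : (r^-1 * ip y h) ^+ 2 <= ip h h by lra.
rewrite exprMn exprVn ler_pdivrMl ?exprn_gt0// ?lt_neqAle ?r0 1?eq_sym ?rn0//.
apply: le_trans (ip_cauchy_schwarz _ _ _) _.
by apply: ler_wpM2r; rewrite ?ip_ge0// r2 lerDr.
Qed.

Lemma defect_step t b K c A y e q
    (r := Num.sqrt (t + ip y y)) (U := Num.max 0 (b - r)) :
  0 <= t -> 0 <= b -> 0 < K -> b ^+ 2 <= K ^+ 2 * A -> c ^+ 2 <= A ->
  let V := U ^+ 2 - 2 * c * ip (U *: (r^-1 *: y)) e + K * c ^+ 2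
      + 2 * c ^+ 2 * ip e e + (K + 2) * A * ip q q in
  0 <= V /\
  Num.max 0 (b - Num.sqrt (t + ip (y + c *: (e + q)) (y + c *: (e + q)))) ^+ 2
     <= V.
Proof.
move=> t0 b0 K0 bA cA V.
set u := r^-1 *: y.
have u1 : ip u u <= 1 by exact: ip_normalized_le1.
have U0 : 0 <= U by rewrite /U le_max lexx.
have Ub : U <= b by rewrite /U ge_max b0 /= lerBlDr lerDl sqrtr_ge0.
have VE : (U - c * ip u (e + q)) ^+ 2 <= V.
  have -> : V = U ^+ 2 - 2 * c * (U * ip u e) + K * c ^+ 2
      + 2 * c ^+ 2 * ip e e + (K + 2) * A * ip q q by rewrite /V ipZl.
  have uq : ip u q ^+ 2 <= ip q q.
    apply: le_trans (ip_cauchy_schwarz _ _ _) _.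
    by rewrite ler_piMl// ip_ge0.
  have ueq : ip u (e + q) ^+ 2 <= 2 * ip e e + 2 * ip q q.
    apply: le_trans (ip_addsq_le _ _).
    apply: le_trans (ip_cauchy_schwarz _ _ _) _.
    by rewrite ler_piMl// ip_ge0.
  have cueq : c ^+ 2 * ip u (e + q) ^+ 2 <= c ^+ 2 * (2 * ip e e) + A * (2 * ip q q).
    apply: le_trans (ler_wpM2l (sqr_ge0 c) ueq) _.
    by rewrite mulrDr lerD2l; apply: ler_wpM2r => //; rewrite mulr_ge0// ip_ge0.
  have UA : U ^+ 2 <= K ^+ 2 * A.
    by apply: le_trans bA; rewrite ler_pXn2r ?nnegrE.
  have Uuq : (U * ip u q) ^+ 2 <= K ^+ 2 * A * ip q q.
    by rewrite exprMn; apply: ler_pM => //; exact: sqr_ge0.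
  have young : - (2 * c * (U * ip u q)) <= K * c ^+ 2 + K * A * ip q q.
    rewrite -(ler_pM2l K0) -subr_ge0.
    have : 0 <= (K * c + U * ip u q) ^+ 2 by exact: sqr_ge0.
    by move: Uuq; nra.
  rewrite sqrrB exprMn ipDr in cueq *.
  by move: cueq young; lra.
split; first exact: le_trans (sqr_ge0 _) VE.
apply: le_trans VE; apply: sqr_maxr0_le.
have := sqrt_ip_convex y (c *: (e + q)) t0; rewrite -/r -/u ipZr => H.
have : b - r <= U by rewrite /U le_max lexx orbT.
by lra.
Qed.

Lemma growth_step_ge th K A c y e q : 0 < th -> ip y y <= K ^+ 2 * A ->
  c ^+ 2 <= A ->
  ip y y + 2 * c * ip y e + (1 - th) * c ^+ 2 * ip e e - th * c ^+ 2
    - (K ^+ 2 + 1) / th * A * ip q q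
  <= ip (y + c *: (e + q)) (y + c *: (e + q)).
Proof.
move=> th0 yA cA.
rewrite ipDD !(ipZr, ipZl) ipDr ipDD.
have q0 := ip_ge0 ip q.
have yq : - (2 * c * ip y q) <= th * c ^+ 2 + K ^+ 2 / th * A * ip q q.
  have H1 : ip y q ^+ 2 <= K ^+ 2 * A * ip q q.
    apply: le_trans (ip_cauchy_schwarz _ _ _) _; exact: ler_wpM2r.
  rewrite -(ler_pM2l th0) mulrDr.
  have -> : th * (K ^+ 2 / th * A * ip q q) = K ^+ 2 * A * ip q q.
    by field; rewrite gt_eqF.
  by have := sqr_ge0 (th * c + ip y q); nra.
have eq2 : - (2 * ip e q) <= th * ip e e + ip q q / th.
  by have := ip_young ip e (- q) th0; rewrite !(ipNr, ipNl) opprK mulrN.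
have ceq : - (c ^+ 2 * (2 * ip e q)) <= th * c ^+ 2 * ip e e + 1 / th * A * ip q q.
  rewrite -mulrN; apply: le_trans (ler_wpM2l (sqr_ge0 c) eq2) _.
  have -> : c ^+ 2 * (th * ip e e + ip q q / th) =
      th * c ^+ 2 * ip e e + 1 / th * (c ^+ 2 * ip q q).
    by field; rewrite gt_eqF.
  rewrite lerD2l -[leRHS]mulrA; apply: ler_wpM2l; first by rewrite divr_ge0// ltW.
  exact: ler_wpM2r.
have cq : 0 <= c ^+ 2 * ip q q by rewrite mulr_ge0 ?sqr_ge0.
by lra.
Qed.

Lemma growth_step_le K A c y e q : ip y y <= K ^+ 2 * A -> c ^+ 2 <= A ->
  ip (y + c *: (e + q)) (y + c *: (e + q))
    <= 3 * K ^+ 2 * A + 3 * c ^+ 2 * ip e e + 3 * A * ip q q.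
Proof.
move=> yA cA; rewrite scalerDr.
have q0 := ip_ge0 ip q.
have H1 : ip (y + (c *: e + c *: q)) (y + (c *: e + c *: q)) <=
   3 * ip y y + 3 * (c ^+ 2 * ip e e) + 3 * (c ^+ 2 * ip q q).
  rewrite ipDD ipDD ipDr !(ipZl, ipZr).
  have := ip_young ip y (c *: e) ltr01; have := ip_young ip y (c *: q) ltr01.
  have := ip_young ip (c *: e) (c *: q) ltr01; rewrite !(ipZl, ipZr).
  by lra.
by have := ler_wpM2r q0 cA; lra.
Qed.

End DeterministicSteps.

Lemma bounded_series_tail (R : realType) (u : nat -> R) (M eta : R) :
  (forall n, 0 <= u n) -> (forall n, \sum_(0 <= i < n) u i <= M) -> 0 < eta ->
  exists n, forall m k, (n <= m)%N -> \sum_(m <= i < (m + k)%N) u i <= eta.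
Proof.
move=> u0 uM eta0.
have ni : nondecreasing_seq (series u).
  by apply/nondecreasing_seqP => n; rewrite /series/= big_nat_recr//= lerDl.
have bu : has_ubound (range (series u)) by exists M => _ [n _ <-]; exact: uM.
have cu := nondecreasing_is_cvgn ni bu.
have /cvgrPdist_le/(_ _ eta0)[n _ Hn] := cu.
exists n => m k nm.
have := Hn m nm; rewrite /= ler_norml => /andP[_].
have := nondecreasing_cvgn_le ni cu (m + k)%N.
rewrite /series/= (@big_cat_nat _ _ _ m 0 (m + k)%N) ?leq_addr//=.
by move=> h1 h2; lra.
Qed.

Section RealIntegral.
Context {R : realType} {disp : measure_display} {T : measurableType disp}
  (P : probability T R).
Implicit Types (A B : set T) (f : T -> R).

Definition pr A := fine (P A).

Lemma prE A : measurable A -> P A = (pr A)%:E.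
Proof. by move=> mA; rewrite /pr fineK// fin_num_measure. Qed.

Lemma pr_ge0 A : 0 <= pr A.
Proof. by rewrite /pr fine_ge0. Qed.

Lemma le_pr A B : measurable A -> measurable B -> A `<=` B -> pr A <= pr B.
Proof. by move=> mA mB AB; rewrite -lee_fin -!prE// le_measure// inE. Qed.

Lemma pr_le1 A : measurable A -> pr A <= 1.
Proof. by move=> mA; rewrite -lee_fin -prE// probability_le1. Qed.

Lemma pr_setID A B : measurable A -> measurable B -> B `<=` A ->
  pr A = pr B + pr (A `\` B).
Proof.
move=> mA mB BA; have mAB : measurable (A `\` B) by exact: measurableD.
apply: EFin_inj; rewrite EFinD -!prE// -measureU//; last first.
  by apply/seteqP; split => // w [? []].
by congr (P _); rewrite setDE setUIr setUv setIT setUidr.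
Qed.

Lemma le_Rintegral_subset A B f : measurable A -> measurable B -> A `<=` B ->
  P.-integrable B (EFin \o f) -> (forall w, B w -> 0 <= f w) ->
  \int[P]_(w in A) f w <= \int[P]_(w in B) f w.
Proof.
move=> mA mB AB iB f0; have iA := integrableS mB mA AB iB.
apply: fine_le; [exact: integrable_fin_num|exact: integrable_fin_num|].
apply: ge0_subset_integral => //.
exact: measurable_int iB.
Qed.

Lemma Rintegral_setID A B f : measurable A -> measurable B -> B `<=` A ->
  P.-integrable A (EFin \o f) ->
  \int[P]_(w in A) f w = \int[P]_(w in B) f w + \int[P]_(w in A `\` B) f w.
Proof.
move=> mA mB BA iA; have mAB : measurable (A `\` B) by exact: measurableD.
have AE : A = B `|` (A `\` B) by rewrite setDE setUIr setUv setIT setUidr.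
rewrite {1}AE Rintegral_setU -?AE//.
by apply/disj_setPS => w [? []].
Qed.

Lemma Rintegral_sum A (I : Type) (s : seq I) (f : I -> T -> R) : measurable A ->
  (forall i, P.-integrable A (EFin \o f i)) ->
  P.-integrable A (EFin \o (fun w => \sum_(i <- s) f i w)) /\
  \int[P]_(w in A) (\sum_(i <- s) f i w) = \sum_(i <- s) \int[P]_(w in A) f i w.
Proof.
move=> mA ifi; elim: s => [|i s [IH1 IH2]].
  split; first by apply: eq_integrable (integrable0 P A) => // w _ /=; rewrite big_nil.
  under eq_Rintegral do rewrite big_nil.
  by rewrite Rintegral_cst// mul0r big_nil.
split.
  by apply: eq_integrable (integrableD mA (ifi i) IH1) => // w _ /=; rewrite big_cons.
under eq_Rintegral do rewrite big_cons.
by rewrite RintegralD// IH2 big_cons.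
Qed.

Lemma pr_eventually_le (E : nat -> set T) D (x : R) :
  (forall n, measurable (E n)) -> measurable D -> (forall n, pr (E n) <= x) ->
  (forall w, D w -> exists m, forall n, (m <= n)%N -> E n w) -> pr D <= x.
Proof.
move=> mE mD Ex DE.
pose Dm m := D `&` \bigcap_(n in [set n | (m <= n)%N]) E n.
have mDm m : measurable (Dm m).
  by apply: measurableI => //; apply: bigcap_measurableType => n _.
have DmU : \bigcup_m Dm m = D.
  apply/seteqP; split => [w [m _ []]//|w Dw].
  by have [m Em] := DE w Dw; exists m => //; split.
have Dm_cvg : P (Dm n) @[n --> \oo] --> P (\bigcup_m Dm m).
  apply: nondecreasing_cvg_mu => //; first by rewrite DmU.
  move=> m n mn; apply/subsetPset => w [Dw Ew]; split => // i /= ni.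
  by apply: Ew => /=; exact: leq_trans ni.
rewrite -lee_fin -prE// -DmU -(cvg_lim _ Dm_cvg)//.
apply: lime_le; first by apply/cvg_ex; eexists; exact: Dm_cvg.
apply: nearW => n; apply: (@le_trans _ _ (P (E n))).
  by apply: le_measure; rewrite ?inE// => w [_]; apply => /=.
by rewrite prE// lee_fin.
Qed.

Lemma pr_bigcap_cvg (E : nat -> set T) (eta : R) :
  (forall n, measurable (E n)) -> (forall n, E n.+1 `<=` E n) -> 0 < eta ->
  exists n, forall m, (n <= m)%N -> pr (E m) <= pr (\bigcap_n E n) + eta.
Proof.
move=> mE ES eta0.
have mI : measurable (\bigcap_n E n) by exact: bigcapT_measurable.
have ni : nonincreasing_seq E.
  by apply/nonincreasing_seqP => n; apply/subsetPset; exact: ES.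
have E_cvg : (P \o E) n @[n --> \oo] --> (pr (\bigcap_n E n))%:E.
  rewrite -prE//; apply: nonincreasing_cvg_mu => //.
  by rewrite (le_lt_trans (probability_le1 _ _))// ltry.
have /fine_cvgP[_ /cvgrPdist_le/(_ _ eta0)[n _ En]] := E_cvg.
exists n => m nm; have := En m nm; rewrite /= -/(pr _) distrC ler_norml => /andP[_].
by rewrite lerBlDl addrC.
Qed.

Lemma le_integrable_real A (f g : T -> R) : measurable A ->
  measurable_fun setT f -> (forall w, A w -> `|f w| <= g w) ->
  P.-integrable A (EFin \o g) -> P.-integrable A (EFin \o f).
Proof.
move=> mA mf fg ig; apply: (le_integrable mA) ig.
  by apply/measurable_EFinP; exact: measurable_funTS.
by move=> w Aw; rewrite !abse_EFin lee_fin (le_trans (fg w Aw))// ler_norm.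
Qed.

End RealIntegral.

Section LinearlyRepelledChain.
Context {R : realType} {d : nat} (ip : {dot 'rV[R]_d for (idfun : R -> R)})
  {disp : measure_display} {T : measurableType disp} (P : probability T R)
  (F : nat -> set (set T)) (c s a2 : nat -> R)
  (X Y e q : nat -> T -> 'rV[R]_d) (good : nat -> set T) (M : R).
Local Notation N x := (ip x x).
Hypotheses
  (hF : filtration F)
  (a2S : forall k, a2 k = c k.+1 ^+ 2 + a2 k.+1)
  (a2_gt0 : forall k, 0 < a2 k)
  (a2_cvg0 : forall eta : R, 0 < eta -> exists k, a2 k < eta)
  (s_ge0 : forall k, 0 <= s k.+1)
  (sM : forall k, s k.+1 <= M * c k.+1 ^+ 2)
  (s_o : forall eta : R, 0 < eta ->
    exists n, forall k, (n <= k)%N -> s k.+1 <= eta * c k.+1 ^+ 2)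
  (M1 : 1 <= M)
  (mX : forall k, coord_mfun (X k : g_sigma_algebraType (F k) -> 'rV[R]_d))
  (mY : forall k, coord_mfun (Y k : g_sigma_algebraType (F k) -> 'rV[R]_d))
  (me : forall k, coord_mfun (e k : g_sigma_algebraType (F k) -> 'rV[R]_d))
  (mq : forall k, coord_mfun (q k : g_sigma_algebraType (F k) -> 'rV[R]_d))
  (Fgood : forall k, F k (good k))
  (goodS : forall k, good k.+1 `<=` good k)
  (recX : forall k w, good k.+1 w ->
    X k.+1 w = Y k w + c k.+1 *: (e k.+1 w + q k.+1 w))
  (XY : forall k w, good k w -> N (X k w) <= N (Y k w) + s k.+1)
  (e_mean : forall k, is_cond_exp_rV P (F k) (e k.+1) (cst 0))
  (e_int : forall k, P.-integrable (good k) (fun w => (N (e k.+1 w))%:E))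
  (e_lb : forall k A, F k A -> A `<=` good k ->
    M^-1 * pr P A <= \int[P]_(w in A) N (e k.+1 w))
  (e_ui : forall del : R, 0 < del -> exists2 L : R, 0 <= L &
    forall k A B, F k A -> A `<=` good k -> measurable B -> B `<=` A ->
      \int[P]_(w in B) N (e k.+1 w) <= L * pr P B + del * pr P A)
  (q_sum : forall n w, \sum_(0 <= i < n) N (q i.+1 w) <= M).

Let F_sa k : sigma_algebra setT (F k). Proof. by case: hF => H _ _; exact: H. Qed.

Let F_sub k : F k `<=` measurable. Proof. by case: hF => _ H _; exact: H. Qed.

Let F_mono m n : (m <= n)%N -> F m `<=` F n.
Proof. by case: hF => _ _ H; exact: H. Qed.

Let F_setI k A B : F k A -> F k B -> F k (A `&` B).
Proof. by rewrite !(measurable_sub _ (F_sa k)); exact: measurableI. Qed.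

Let mgood k : measurable (good k). Proof. exact: F_sub. Qed.

Let coord_sub k (V : T -> 'rV[R]_d) :
  coord_mfun (V : g_sigma_algebraType (F k) -> 'rV[R]_d) -> coord_mfun V.
Proof. by move=> mV i; exact: (measurable_fun_sub (@F_sub k) (mV i)). Qed.

Let mN k (V : T -> 'rV[R]_d) :
  coord_mfun (V : g_sigma_algebraType (F k) -> 'rV[R]_d) ->
  measurable_fun setT (fun w => N (V w)).
Proof. by move=> /coord_sub mV; exact: measurable_ip. Qed.

Let a2_anti m n : (m <= n)%N -> a2 n <= a2 m.
Proof.
elim: n => [|n IH]; first by rewrite leqn0 => /eqP ->.
rewrite leq_eqVlt => /predU1P[->//|/IH]; apply: le_trans.
by rewrite [leRHS]a2S lerDr sqr_ge0.
Qed.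

Let c_le_a2 m n : (m <= n)%N -> c n.+1 ^+ 2 <= a2 m.
Proof.
move=> /a2_anti; apply: le_trans.
by rewrite a2S lerDl ltW.
Qed.

Let q_le i w : N (q i.+1 w) <= M.
Proof.
apply: le_trans (q_sum i.+1 w); rewrite big_nat_recr//= lerDr.
by apply: sumr_ge0 => j _; exact: ip_ge0.
Qed.

Let int_cst A (r : R) : measurable A -> P.-integrable A (EFin \o (fun=> r)).
Proof. by move=> mA; exact: finite_measure_integrable_cst. Qed.

Let int_q A i : measurable A -> P.-integrable A (EFin \o (fun w => N (q i.+1 w))).
Proof.
move=> mA; apply: (le_integrable_real mA (mN (@mq i.+1)) _ (int_cst M mA)) => w _.
by rewrite ger0_norm ?ip_ge0.
Qed.

Let int_e k A : measurable A -> A `<=` good k ->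
  P.-integrable A (EFin \o (fun w => N (e k.+1 w))).
Proof. by move=> mA Ag; exact: integrableS (mgood k) mA Ag (e_int k). Qed.

Let defect (t b : R) (V : T -> 'rV[R]_d) (w : T) : R :=
  Num.max 0 (b - Num.sqrt (t + N (V w))).

Let mdefect d' (T' : measurableType d') t b (V : T' -> 'rV[R]_d) :
  coord_mfun V ->
  measurable_fun setT (fun w => Num.max 0 (b - Num.sqrt (t + N (V w)))).
Proof.
move=> mV; apply: measurable_maxr => //; apply: measurable_funB => //.
apply: measurableT_comp; first exact: (continuous_measurable_fun (@sqrt_continuous R)).
by apply: measurable_funD => //; exact: measurable_ip.
Qed.

Let defect_bd t b V w : 0 <= b -> 0 <= defect t b V w <= b.
Proof.
move=> b0; rewrite /defect le_max lexx ge_max b0 /= lerBlDr lerDl; exact: sqrtr_ge0.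
Qed.

Let int_defect2 k A t b V : measurable A -> 0 <= b ->
  coord_mfun (V : g_sigma_algebraType (F k) -> 'rV[R]_d) ->
  P.-integrable A (EFin \o (fun w => defect t b V w ^+ 2)).
Proof.
move=> mA b0 mV; apply: (@le_integrable_real _ _ _ _ _ _ (fun=> b ^+ 2)) => //.
- apply: measurable_funX; exact: mdefect (coord_sub mV).
- move=> w _; have /andP[? ?] := @defect_bd t b V w b0.
  by rewrite ger0_norm ?sqr_ge0// ler_pXn2r ?nnegrE.
- exact: int_cst.
Qed.

Let Y_normalized_mfun t b k : 0 <= t -> coord_mfun ((fun w =>
  defect t b (Y k) w *: ((Num.sqrt (t + N (Y k w)))^-1 *: Y k w))
    : g_sigma_algebraType (F k) -> 'rV[R]_d).
Proof.
move=> t0; apply: coord_mfunZ; first exact: mdefect.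
apply: coord_mfunZ => //.
have -> : (fun w => (Num.sqrt (t + N (Y k w)))^-1) =
    (fun w => Num.sqrt (t + N (Y k w)) `^ (-1)).
  by apply/funext => w; rewrite powR_inv1// sqrtr_ge0.
apply: (measurableT_comp (measurable_powR _)).
apply: (measurableT_comp (continuous_measurable_fun (@sqrt_continuous R))).
by apply: measurable_funD => //; exact: measurable_ip.
Qed.

Let defect_integral_step j H t b K A C :
  F j H -> 0 <= t -> 0 <= b -> 0 < K -> b ^+ 2 <= K ^+ 2 * A ->
  c j.+1 ^+ 2 <= A ->
  (forall B, F j B -> B `<=` good j ->
    \int[P]_(w in B) N (e j.+1 w) <= C * pr P B) -> 0 <= C ->
  \int[P]_(w in H `&` good j.+1) (defect t b (X j.+1) w ^+ 2) <=
  \int[P]_(w in H `&` good j) (defect t b (Y j) w ^+ 2)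
  + (K + 2 * C) * c j.+1 ^+ 2 * pr P H
  + (K + 2) * A * \int[P]_(w in H) N (q j.+1 w).
Proof.
move=> FH t0 b0 K0 bA cA eC C0.
have mH := F_sub FH.
have FHj : F j (H `&` good j) by exact: F_setI.
have mHj := F_sub FHj.
have mHj1 : measurable (H `&` good j.+1) by exact: measurableI.
have Hg : H `&` good j `<=` good j by move=> w [].
pose u w := defect t b (Y j) w *: ((Num.sqrt (t + N (Y j w)))^-1 *: Y j w).
have [iu u0] : P.-integrable (H `&` good j) (fun w => (ip (u w) (e j.+1 w))%:E) /\
    \int[P]_(w in H `&` good j) ip (u w) (e j.+1 w) = 0.
  apply: (@integrable_ip_orthogonal _ _ _ P _ (F_sa j) (@F_sub j) _ ip _ u (e j.+1) (b ^+ 2)) => //.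
  - exact: Y_normalized_mfun.
  - exact: coord_sub.
  - exact: int_e.
  - move=> w _; rewrite /u ipZl ipZr mulrA -expr2.
    have /andP[D0 Db] := @defect_bd t b (Y j) w b0.
    apply: (@le_trans _ _ (defect t b (Y j) w ^+ 2)).
      by rewrite ler_piMr ?sqr_ge0// ip_normalized_le1.
    by rewrite ler_pXn2r ?nnegrE.
pose V w := defect t b (Y j) w ^+ 2 - 2 * c j.+1 * ip (u w) (e j.+1 w)
  + K * c j.+1 ^+ 2 + 2 * c j.+1 ^+ 2 * N (e j.+1 w) + (K + 2) * A * N (q j.+1 w).
have iD : P.-integrable (H `&` good j) (EFin \o (fun w => defect t b (Y j) w ^+ 2)).
  exact: int_defect2 (@mY j).
have ie : P.-integrable (H `&` good j) (EFin \o (fun w => N (e j.+1 w))) by exact: int_e.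
have iq : P.-integrable (H `&` good j) (EFin \o (fun w => N (q j.+1 w))) by exact: int_q.
have i1 := integrableZl mHj (2 * c j.+1) iu.
have i2 := integrableB mHj iD i1.
have i3 := integrableD mHj i2 (int_cst (K * c j.+1 ^+ 2) mHj).
have i4' := integrableZl mHj (2 * c j.+1 ^+ 2) ie.
have i4 := integrableD mHj i3 i4'.
have i5' := integrableZl mHj ((K + 2) * A) iq.
have iV : P.-integrable (H `&` good j) (EFin \o V) := integrableD mHj i4 i5'.
have VE : \int[P]_(w in H `&` good j) V w =
    \int[P]_(w in H `&` good j) (defect t b (Y j) w ^+ 2)
    + K * c j.+1 ^+ 2 * pr P (H `&` good j)
    + 2 * c j.+1 ^+ 2 * \int[P]_(w in H `&` good j) N (e j.+1 w)
    + (K + 2) * A * \int[P]_(w in H `&` good j) N (q j.+1 w).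
  rewrite /V RintegralD// RintegralD// RintegralD// ?int_cst// RintegralB//.
  by rewrite Rintegral_cst// (RintegralZl _ mHj iu) u0 mulr0 subr0 (RintegralZl _ mHj ie) (RintegralZl _ mHj iq).
have Vstep w : 0 <= V w /\ (good j.+1 w -> defect t b (X j.+1) w ^+ 2 <= V w).
  have [V0 Vle] := @defect_step R d ip t b K (c j.+1) A
    (Y j w) (e j.+1 w) (q j.+1 w) t0 b0 K0 bA cA.
  split; first exact: V0.
  by move=> gw; rewrite /defect (recX gw); exact: Vle.
have mono : \int[P]_(w in H `&` good j.+1) (defect t b (X j.+1) w ^+ 2) <=
    \int[P]_(w in H `&` good j) V w.
  apply: le_trans (le_Rintegral_subset mHj1 mHj _ iV _).
  - apply: le_Rintegral => //.
    + exact: int_defect2 (@mX j.+1).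
    + by apply: integrableS iV => // w [Hw /goodS].
    + by move=> w [_ gw]; exact: (Vstep w).2.
  - by move=> w [Hw /goodS].
  - by move=> w _; exact: (Vstep w).1.
apply: le_trans mono _; rewrite VE.
have pH : pr P (H `&` good j) <= pr P H by apply: le_pr => // w [].
have qH : \int[P]_(w in H `&` good j) N (q j.+1 w) <= \int[P]_(w in H) N (q j.+1 w).
  by apply: le_Rintegral_subset => //; [exact: int_q|move=> w _; exact: ip_ge0].
have eH := eC _ FHj Hg.
have A0 : 0 <= A by exact: le_trans (sqr_ge0 _) cA.
have c0 : 0 <= c j.+1 ^+ 2 by exact: sqr_ge0.
rewrite -!addrA lerD2l.
have h1 : (K + 2) * A * \int[P]_(w in H `&` good j) N (q j.+1 w)
   <= (K + 2) * A * \int[P]_(w in H) N (q j.+1 w).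
  by apply: ler_wpM2l => //; rewrite mulr_ge0// addr_ge0// ltW.
have h2 : 2 * c j.+1 ^+ 2 * \int[P]_(w in H `&` good j) N (e j.+1 w) <=
    2 * c j.+1 ^+ 2 * (C * pr P H).
  apply: ler_wpM2l; first by rewrite mulr_ge0.
  by apply: le_trans eH _; exact: ler_wpM2l.
have h3 : K * c j.+1 ^+ 2 * pr P (H `&` good j) <= K * c j.+1 ^+ 2 * pr P H.
  by apply: ler_wpM2l => //; rewrite mulr_ge0// ltW.
by move: h1 h2 h3; lra.
Qed.

Let defect_chain k H K C (b := K * Num.sqrt (a2 k)) :
  F k H -> H `<=` good k -> 0 < K ->
  (forall w, H w -> K ^+ 2 * a2 k <= N (Y k w)) -> 0 <= C ->
  (forall j B, F j B -> B `<=` good j ->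
    \int[P]_(w in B) N (e j.+1 w) <= C * pr P B) ->
  forall n,
  \int[P]_(w in H `&` good (k + n)%N)
    (defect (\sum_(k <= i < (k + n).+1) s i.+1) b (Y (k + n)%N) w ^+ 2)
  <= (K + 2 * C) * (\sum_(k <= i < (k + n)%N) c i.+1 ^+ 2) * pr P H
   + (K + 2) * a2 k * \sum_(k <= i < (k + n)%N) \int[P]_(w in H) N (q i.+1 w).
Proof.
move=> FH Hg K0 KY C0 eC.
have mH := F_sub FH.
have b0 : 0 <= b by rewrite mulr_ge0 ?sqrtr_ge0// ltW.
have b2 : b ^+ 2 = K ^+ 2 * a2 k by rewrite exprMn sqr_sqrtr// ltW.
have b2le : b ^+ 2 <= K ^+ 2 * a2 k by rewrite b2.
elim=> [|n IH].
  rewrite addn0 !(big_geq (leqnn k)) !mulr0 mul0r addr0.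
  rewrite (@eq_Rintegral _ _ _ _ _ (fun=> 0)) ?Rintegral_cst ?mul0r//.
    exact: measurableI.
  move=> w; rewrite inE => -[Hw _]; rewrite /defect.
  rewrite (_ : Num.max _ _ = 0) ?expr0n//.
  apply/max_idPl; rewrite subr_le0 -(@ler_pXn2r _ 2) ?nnegrE ?sqrtr_ge0//.
  rewrite b2 sqr_sqrtr ?addr_ge0 ?ip_ge0 ?sumr_ge0//.
  by apply: le_trans (KY w Hw) _; rewrite lerDr big_nat1.
rewrite !addnS.
have t0 : 0 <= \sum_(k <= i < (k + n).+1) s i.+1 by exact: sumr_ge0.
have FHn : F (k + n)%N H by apply: F_mono FH; rewrite leq_addr.
have := defect_integral_step FHn t0 b0 K0 b2le (c_le_a2 (leq_addr n k)) (eC _) C0.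
set t := \sum_(k <= i < (k + n).+1) s i.+1.
have mHn : measurable (H `&` good (k + n).+1) by exact: measurableI.
have : \int[P]_(w in H `&` good (k + n).+1)
      (defect (\sum_(k <= i < (k + n).+2) s i.+1) b (Y (k + n).+1) w ^+ 2) <=
    \int[P]_(w in H `&` good (k + n).+1) (defect t b (X (k + n).+1) w ^+ 2).
  apply: le_Rintegral => //.
  - exact: int_defect2 (@mY (k + n).+1).
  - exact: int_defect2 (@mX (k + n).+1).
  - move=> w [_ gw]; rewrite /defect; apply: sqr_maxr0_le.
    rewrite le_max; apply/orP; right; apply: lerB => //; rewrite ler_sqrt.
      rewrite big_nat_recr/= -/t; last by rewrite leqW// leq_addr.
      by have := XY gw; lra.
    apply: addr_ge0; last exact: ip_ge0.
    by apply: sumr_ge0.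
rewrite [in X in _ -> _ -> _ <= X]big_nat_recr ?leq_addr//=.
rewrite [in X in _ -> _ -> _ <= _ + X]big_nat_recr ?leq_addr//=.
by move: IH; rewrite -/t; lra.
Qed.

Lemma no_return : exists2 C, 0 < C & forall K k H D, 1 <= K -> 16 * M <= K ^+ 2 ->
  F k H -> H `<=` good k ->
  (forall w, H w -> K ^+ 2 * a2 k <= N (Y k w)) ->
  measurable D -> D `<=` H ->
  (forall w, D w -> (forall n, good n w) /\
    forall eta : R, 0 < eta -> exists m, forall n, (m <= n)%N -> N (X n w) <= eta) ->
  pr P D <= C / K * pr P H.
Proof.
have [L L0 eL] := e_ui ltr01.
have C0 : 0 <= L + 1 by rewrite addr_ge0.
have eC j B : F j B -> B `<=` good j ->
    \int[P]_(w in B) N (e j.+1 w) <= (L + 1) * pr P B.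
  by move=> FB Bg; rewrite mulrDl; apply: eL => //; exact: F_sub FB.
exists (4 * (1 + 2 * (L + 1) + 3 * M)); first by move: L0 M1; lra.
move=> K k H D K1 KM FH Hg KY mD DH Dlim.
have K0 : 0 < K by exact: lt_le_trans K1.
have mH := F_sub FH.
pose b := K * Num.sqrt (a2 k).
have b0 : 0 <= b by rewrite mulr_ge0 ?sqrtr_ge0// ltW.
have b2 : b ^+ 2 = K ^+ 2 * a2 k by rewrite exprMn sqr_sqrtr// ltW.
have b2le : b ^+ 2 <= K ^+ 2 * a2 k by rewrite b2.
have sum_c n : \sum_(k <= i < (k + n)%N) c i.+1 ^+ 2 <= a2 k.
  have -> : \sum_(k <= i < (k + n)%N) c i.+1 ^+ 2 = a2 k - a2 (k + n)%N.
    elim: n => [|n IH]; first by rewrite addn0 big_geq ?leqnn// subrr.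
    by rewrite addnS big_nat_recr ?leq_addr//= IH (a2S (k + n)); lra.
  by rewrite lerBlDr lerDl ltW.
have sum_q n : \sum_(k <= i < (k + n)%N) \int[P]_(w in H) N (q i.+1 w) <= M * pr P H.
  have [I1 I2] := @Rintegral_sum _ _ _ P H _ (index_iota k (k + n)%N)
    (fun i w => N (q i.+1 w)) mH (fun i => @int_q H i mH).
  rewrite -I2 -Rintegral_cst//; apply: le_Rintegral => //; first exact: int_cst.
  move=> w _; apply: le_trans (q_sum (k + n) w).
  rewrite (@big_cat_nat _ _ _ k 0 (k + n)%N)
    ?leq_addr//= lerDr.
  by apply: sumr_ge0 => i _; exact: ip_ge0.
pose E n := (H `&` good (k + n).+1) `&`
  [set w | N (X (k + n).+1 w) <= K ^+ 2 * a2 k / 16].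
have mE n : measurable (E n).
  apply: measurableI; first exact: measurableI.
  rewrite -[X in measurable X]setTI.
  by apply: measurable_fun_le => //; exact: mN (@mX _).
apply: (@pr_eventually_le _ _ _ P E) => //; last first.
  move=> w Dw; have [gw lw] := Dlim w Dw.
  have [|m Hm] := lw (K ^+ 2 * a2 k / 16).
    by rewrite divr_gt0// mulr_gt0// exprn_gt0.
  exists m => n mn; split; first by split; [exact: DH|exact: gw].
  by apply: Hm; rewrite (leq_trans mn)// leqW// leq_addl.
move=> n.
have t0 : 0 <= \sum_(k <= i < (k + n).+1) s i.+1 by exact: sumr_ge0.
have FHn : F (k + n)%N H by apply: F_mono FH; rewrite leq_addr.
have Hstep := defect_integral_step FHn t0 b0 K0 b2le (c_le_a2 (leq_addr n k)) (eC _) C0.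
have Hchain := defect_chain FH Hg K0 KY C0 eC n.
have tle : \sum_(k <= i < (k + n).+1) s i.+1 <= K ^+ 2 * a2 k / 16.
  apply: (@le_trans _ _ (M * a2 k)).
    apply: le_trans (ler_wpM2l _ (sum_c n.+1)); last exact: le_trans M1.
    by rewrite addnS mulr_sumr; apply: ler_sum.
  by rewrite ler_pdivlMr// mulrAC; apply: ler_wpM2r; [exact: ltW|rewrite mulrC].
have mHn : measurable (H `&` good (k + n).+1) by exact: measurableI.
have Hcheb : K ^+ 2 * a2 k / 4 * pr P (E n) <=
    \int[P]_(w in H `&` good (k + n).+1)
      (defect (\sum_(k <= i < (k + n).+1) s i.+1) b (X (k + n).+1) w ^+ 2).
  rewrite -Rintegral_cst//.
  have iD A : measurable A -> P.-integrable A (EFin \o (fun w =>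
      defect (\sum_(k <= i < (k + n).+1) s i.+1) b (X (k + n).+1) w ^+ 2)).
    by move=> mA; exact: int_defect2 (@mX _).
  apply: le_trans (le_Rintegral_subset (mE n) mHn _ (iD _ mHn) _).
  - apply: le_Rintegral => //; [exact: int_cst|exact: iD|].
    move=> w [_ /= Nw]; rewrite /defect.
    have -> : K ^+ 2 * a2 k / 4 = (b / 2) ^+ 2 by rewrite exprMn b2; field.
    rewrite ler_pXn2r ?nnegrE ?divr_ge0//; last by rewrite le_max lexx.
    rewrite le_max; apply/orP; right.
    rewrite lerBrDl -lerBrDr (_ : b - b / 2 = b / 2); last by field.
    rewrite -(@ler_pXn2r _ 2) ?nnegrE ?sqrtr_ge0 ?divr_ge0//.
    rewrite sqr_sqrtr ?addr_ge0 ?ip_ge0// exprMn b2.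
    have : 0 <= K ^+ 2 * a2 k by rewrite -b2 sqr_ge0.
    by move: tle Nw; set t := \sum_(_ <= _ < _) _; lra.
  - by move=> w [].
  - by move=> w _; exact: sqr_ge0.
have p0 := pr_ge0 P H.
have a0 := a2_gt0 k.
have total : K ^+ 2 * a2 k / 4 * pr P (E n) <=
    K * a2 k * (1 + 2 * (L + 1) + 3 * M) * pr P H.
  apply: le_trans Hcheb _; apply: le_trans Hstep _.
  move: Hchain; rewrite -/b; set Z := \int[P]_(w in _) _ => h1.
  have := sum_c n.+1; have := sum_q n.+1.
  rewrite !addnS !big_nat_recr ?leq_addr//=; move: h1.
  set Sc := \sum_(_ <= _ < _) _; set Sq := \sum_(_ <= _ < _) _.
  set Iq := \int[P]_(w in H) _ => h1 h2 h3.
  have h4 : (K + 2 * (L + 1)) * (Sc + c (k + n).+1 ^+ 2) * pr P H <=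
      (K + 2 * (L + 1)) * a2 k * pr P H.
    apply: ler_wpM2r => //; apply: ler_wpM2l => //.
    by rewrite addr_ge0 ?mulr_ge0// ltW.
  have h5 : (K + 2) * a2 k * (Sq + Iq) <= (K + 2) * a2 k * (M * pr P H).
    by apply: ler_wpM2l => //; rewrite mulr_ge0 ?ltW// addr_gt0.
  have h6 : (K + 2 * (L + 1)) * a2 k * pr P H + (K + 2) * a2 k * (M * pr P H)
      <= K * a2 k * (1 + 2 * (L + 1) + 3 * M) * pr P H.
    rewrite -subr_ge0.
    have -> : K * a2 k * (1 + 2 * (L + 1) + 3 * M) * pr P H -
      ((K + 2 * (L + 1)) * a2 k * pr P H + (K + 2) * a2 k * (M * pr P H)) =
      (K - 1) * (2 * (L + 1) + 2 * M) * (a2 k * pr P H) by ring.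
    apply: mulr_ge0; last by rewrite mulr_ge0// ltW.
    by apply: mulr_ge0; [rewrite subr_ge0|move: L0 M1; lra].
  by move: h1 h4 h5 h6; lra.
rewrite -(ler_pM2l (_ : 0 < K ^+ 2 * a2 k / 4)); last first.
  by rewrite divr_gt0// mulr_gt0// exprn_gt0.
apply: le_trans total _; rewrite le_eqVlt; apply/orP; left; apply/eqP.
by field; rewrite gt_eqF.
Qed.

(* The event that the exit time of the region [|Y_j| <= K sqrt (a2 j)] is after
   [k]. *)
Let stay (K : R) k : set T :=
  [set w | good k w /\ forall j, (j <= k)%N -> N (Y j w) <= K ^+ 2 * a2 j].

Let stayS K k : stay K k.+1 `<=` stay K k.
Proof. by move=> w [/goodS gw YK]; split=> // j /leqW; exact: YK. Qed.

Lemma F_stay K k : F k (stay K k).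
Proof.
have FYk j : F j [set w | N (Y j w) <= K ^+ 2 * a2 j].
  rewrite (measurable_sub _ (F_sa j)) -[X in measurable X]setTI.
  by apply: measurable_fun_le => //; exact: measurable_ip.
elim: k => [|k IH].
  rewrite (_ : stay K 0 = good 0%N `&` [set w | N (Y 0%N w) <= K ^+ 2 * a2 0%N]).
    exact: F_setI.
  apply/seteqP; split => w /= [gw Yw]; split=> //; first exact: Yw.
  by move=> j; rewrite leqn0 => /eqP ->.
rewrite (_ : stay K k.+1 = good k.+1 `&`
  (stay K k `&` [set w | N (Y k.+1 w) <= K ^+ 2 * a2 k.+1])).
  by apply: F_setI => //; apply: F_setI => //; exact: F_mono IH.
apply/seteqP; split => [w sw|w [gw [sw Yw]]].
  by split; [exact: sw.1|split; [exact: stayS|exact: sw.2]].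
split=> // j; rewrite leq_eqVlt ltnS => /predU1P[->//|]; exact: sw.2.
Qed.

Let mstay K k : measurable (stay K k). Proof. exact: (F_sub (F_stay K k)). Qed.

Let growth_integral_step K n k (th := M^-1 / 4) del L :
  (n <= k)%N -> s k.+1 <= M^-1 / 8 * c k.+1 ^+ 2 -> 0 < del -> 0 <= L ->
  (forall A B, F k A -> A `<=` good k -> measurable B -> B `<=` A ->
     \int[P]_(w in B) N (e k.+1 w) <= L * pr P B + del * pr P A) ->
  \int[P]_(w in stay K k) N (X k w) + M^-1 / 4 * c k.+1 ^+ 2 * pr P (stay K k)
  <= \int[P]_(w in stay K k.+1) N (X k.+1 w)
     + a2 n * ((3 * K ^+ 2 + 3 * L) * (pr P (stay K k) - pr P (stay K k.+1))
               + ((K ^+ 2 + 1) / th + 3) * \int[P]_w N (q k.+1 w))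
     + 3 * del * c k.+1 ^+ 2.
Proof.
move=> nk ss del0 L0 eL.
have M0 : 0 < M by exact: lt_le_trans M1.
have v0 : 0 < M^-1 by rewrite invr_gt0.
have v1 : M^-1 <= 1 by rewrite invf_le1.
have th0 : 0 < th by rewrite divr_gt0.
have mS := mstay K k; have mS1 := mstay K k.+1.
have mSD : measurable (stay K k `\` stay K k.+1) by exact: measurableD.
have Sg : stay K k `<=` good k by move=> w [].
have a2k : a2 k <= a2 n by exact: a2_anti.
have cn : c k.+1 ^+ 2 <= a2 n by exact: c_le_a2.
have YB w : stay K k w -> N (Y k w) <= K ^+ 2 * a2 n.
  by move=> [_ /(_ k (leqnn k))] /le_trans; apply; apply: ler_wpM2l; rewrite ?sqr_ge0.
pose Z w := Y k w + c k.+1 *: (e k.+1 w + q k.+1 w).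
have ie : P.-integrable (stay K k) (EFin \o (fun w => N (e k.+1 w))) by exact: int_e.
have iq A : measurable A -> P.-integrable A (EFin \o (fun w => N (q k.+1 w))).
  by move=> mA; exact: int_q.
have iY : P.-integrable (stay K k) (EFin \o (fun w => N (Y k w))).
  apply: (le_integrable_real mS (mN (@mY k)) _ (int_cst (K ^+ 2 * a2 n) mS)) => w Sw.
  by rewrite ger0_norm ?ip_ge0//; exact: YB.
have iX : P.-integrable (stay K k) (EFin \o (fun w => N (X k w))).
  apply: (le_integrable_real mS (mN (@mX k)) _ (int_cst (K ^+ 2 * a2 n + s k.+1) mS)) => w Sw.
  rewrite ger0_norm ?ip_ge0//; apply: le_trans (XY (Sg _ Sw)) _.
  by rewrite lerD2r; exact: YB.
have [iYe Ye0] : P.-integrable (stay K k) (fun w => (ip (Y k w) (e k.+1 w))%:E) /\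
    \int[P]_(w in stay K k) ip (Y k w) (e k.+1 w) = 0.
  apply: (@integrable_ip_orthogonal _ _ _ P _ (F_sa k) (@F_sub k) _ ip _ (Y k) (e k.+1) (K ^+ 2 * a2 n)) => //.
  - exact: F_stay.
  - exact: coord_sub.
pose U w := 3 * K ^+ 2 * a2 n + 3 * c k.+1 ^+ 2 * N (e k.+1 w) + 3 * a2 n * N (q k.+1 w).
have iU : P.-integrable (stay K k) (EFin \o U).
  have l1 := integrableZl mS (3 * c k.+1 ^+ 2) ie.
  have l2 := integrableD mS (int_cst (3 * K ^+ 2 * a2 n) mS) l1.
  exact: (integrableD mS l2 (integrableZl mS (3 * a2 n) (iq _ mS))).
have ZU w : stay K k w -> N (Z w) <= U w.
  by move=> Sw; apply: growth_step_le => //; exact: YB.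
have iZ : P.-integrable (stay K k) (EFin \o (fun w => N (Z w))).
  apply: (le_integrable_real mS _ _ iU) => [|w Sw]; last first.
    by rewrite ger0_norm ?ip_ge0//; exact: ZU.
  have mZ : coord_mfun Z.
    apply: coord_mfunD; first exact: coord_sub.
    apply: coord_mfunZ => //.
    by apply: coord_mfunD; exact: coord_sub.
  exact: measurable_ip.
pose W w := N (Y k w) + 2 * c k.+1 * ip (Y k w) (e k.+1 w)
  + (1 - th) * c k.+1 ^+ 2 * N (e k.+1 w) - th * c k.+1 ^+ 2
  - (K ^+ 2 + 1) / th * a2 n * N (q k.+1 w).
have j1 := integrableZl mS (2 * c k.+1) iYe.
have j2 := integrableD mS iY j1.
have j3' := integrableZl mS ((1 - th) * c k.+1 ^+ 2) ie.
have j3 := integrableD mS j2 j3'.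
have j4 := integrableB mS j3 (int_cst (th * c k.+1 ^+ 2) mS).
have j5' := integrableZl mS ((K ^+ 2 + 1) / th * a2 n) (iq _ mS).
have iW : P.-integrable (stay K k) (EFin \o W) := integrableB mS j4 j5'.
have WE : \int[P]_(w in stay K k) W w =
    \int[P]_(w in stay K k) N (Y k w)
    + (1 - th) * c k.+1 ^+ 2 * \int[P]_(w in stay K k) N (e k.+1 w)
    - th * c k.+1 ^+ 2 * pr P (stay K k)
    - (K ^+ 2 + 1) / th * a2 n * \int[P]_(w in stay K k) N (q k.+1 w).
  rewrite /W RintegralB// RintegralB// ?int_cst// RintegralD// RintegralD//.
  by rewrite Rintegral_cst// (RintegralZl _ mS iYe) Ye0 mulr0 addr0
    (RintegralZl _ mS ie) (RintegralZl _ mS (iq _ mS)).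
have WZ : \int[P]_(w in stay K k) W w <= \int[P]_(w in stay K k) N (Z w).
  apply: le_Rintegral => // w Sw; apply: growth_step_ge => //; exact: YB.
have XYi : \int[P]_(w in stay K k) N (X k w) <=
    \int[P]_(w in stay K k) N (Y k w) + s k.+1 * pr P (stay K k).
  rewrite -Rintegral_cst// -RintegralD//; last exact: int_cst.
  apply: le_Rintegral => //; first exact: (integrableD mS iY (int_cst (s k.+1) mS)).
  by move=> w /Sg; exact: XY.
have ZX : \int[P]_(w in stay K k.+1) N (Z w) = \int[P]_(w in stay K k.+1) N (X k.+1 w).
  by apply: eq_Rintegral => w; rewrite inE => -[gw _]; rewrite (recX gw).
have exit : \int[P]_(w in stay K k `\` stay K k.+1) N (Z w) <=
    3 * K ^+ 2 * a2 n * pr P (stay K k `\` stay K k.+1)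
    + 3 * c k.+1 ^+ 2 * (L * pr P (stay K k `\` stay K k.+1) + del * pr P (stay K k))
    + 3 * a2 n * \int[P]_w N (q k.+1 w).
  have DS : stay K k `\` stay K k.+1 `<=` stay K k by move=> w [].
  have iDe := integrableS mS mSD DS ie.
  apply: (@le_trans _ _ (\int[P]_(w in stay K k `\` stay K k.+1) U w)).
    apply: le_Rintegral => //.
    - exact: integrableS mS mSD DS iZ.
    - exact: integrableS mS mSD DS iU.
    - by move=> w [Sw _]; exact: ZU.
  have k1 := integrableZl mSD (3 * c k.+1 ^+ 2) iDe.
  have k2 := integrableD mSD (int_cst (3 * K ^+ 2 * a2 n) mSD) k1.
  have k3 := integrableZl mSD (3 * a2 n) (iq _ mSD).
  rewrite /U RintegralD// RintegralD// ?int_cst// Rintegral_cst//.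
  rewrite (RintegralZl _ mSD iDe) (RintegralZl _ mSD (iq _ mSD)).
  apply: lerD; first rewrite lerD2l.
    apply: ler_wpM2l; first by rewrite mulr_ge0 ?sqr_ge0.
    by apply: eL => //; exact: F_stay.
  apply: ler_wpM2l; first by rewrite mulr_ge0// ltW.
  by apply: le_Rintegral_subset => //; [exact: iq|move=> w _; exact: ip_ge0].
have pD : pr P (stay K k `\` stay K k.+1) = pr P (stay K k) - pr P (stay K k.+1).
  by rewrite (pr_setID P mS mS1 (@stayS K k)) addrC addKr.
have := Rintegral_setID mS mS1 (@stayS K k) iZ; rewrite ZX => Zsplit.
have elb := e_lb (F_stay K k) Sg.
have qT : \int[P]_(w in stay K k) N (q k.+1 w) <= \int[P]_w N (q k.+1 w).
  by apply: le_Rintegral_subset => //; [exact: iq|move=> w _; exact: ip_ge0].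
have p0 := pr_ge0 P (stay K k).
have p1 : pr P (stay K k) <= 1 by exact: pr_le1.
have c0 : 0 <= c k.+1 ^+ 2 by exact: sqr_ge0.
have pD0 := pr_ge0 P (stay K k `\` stay K k.+1).
move: WE WZ XYi exit Zsplit elb qT; rewrite -pD.
set IX := \int[P]_(w in _) N (X k w); set IX1 := \int[P]_(w in _) N (X k.+1 w).
set IW := \int[P]_(w in _) W w; set IY := \int[P]_(w in _) N (Y k w).
set IZ := \int[P]_(w in _) N (Z w).
set ID := \int[P]_(w in _ `\` _) N (Z w); set Ie := \int[P]_(w in _) N (e k.+1 w).
set Iq := \int[P]_(w in _) N (q k.+1 w); set IqT := \int[P]_w N (q k.+1 w).
set p := pr P (stay K k) in p0 p1 *; set pd := pr P _ in pD0 *.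
set c2 := c k.+1 ^+ 2 in c0 cn ss *; set A := a2 n in cn *.
move=> WE WZ XYi exit Zsplit elb qT.
have g1 : (1 - th) * c2 * (M^-1 * p) <= (1 - th) * c2 * Ie.
  by apply: ler_wpM2l => //; rewrite mulr_ge0// subr_ge0 /th; lra.
have g2 : s k.+1 * p <= M^-1 / 8 * c2 * p by exact: ler_wpM2r.
have g3 : (K ^+ 2 + 1) / th * A * Iq <= (K ^+ 2 + 1) / th * A * IqT.
  apply: ler_wpM2l => //; rewrite mulr_ge0//; last exact: ltW (a2_gt0 n).
  by rewrite divr_ge0// ?addr_ge0 ?sqr_ge0// ltW.
have g4 : 3 * c2 * (L * pd) <= 3 * A * (L * pd).
  by apply: ler_wpM2r; [rewrite mulr_ge0|rewrite ler_pM2l].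
have g5 : 3 * c2 * (del * p) <= 3 * c2 * (del * 1).
  by apply: ler_wpM2l; [rewrite mulr_ge0|apply: ler_wpM2l => //; exact: ltW].
have g6 : 3 / 8 * M^-1 * (c2 * p) <= (1 - th) * c2 * (M^-1 * p) - th * c2 * p - M^-1 / 8 * c2 * p.
  have -> : (1 - th) * c2 * (M^-1 * p) - th * c2 * p - M^-1 / 8 * c2 * p =
     (M^-1 - M^-1 / 4 * M^-1 - M^-1 / 4 - M^-1 / 8) * (c2 * p) by rewrite /th; ring.
  apply: ler_wpM2r; first exact: mulr_ge0.
  have : M^-1 * M^-1 <= M^-1 * 1 by rewrite ler_pM2l.
  by lra.
have g7 : 0 <= M^-1 * (c2 * p) by apply: mulr_ge0; [exact: ltW|exact: mulr_ge0].
rewrite mulrDr mulrA.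
move: WE; set LQ := (K ^+ 2 + 1) / th in g3 * => WE.
by lra.
Qed.

Lemma stay_null K : pr P (\bigcap_k stay K k) = 0.
Proof.
set p := pr P _.
have p0 : 0 <= p by exact: pr_ge0.
apply/eqP; rewrite eq_le p0 andbT leNgt; apply/negP => pp.
have v0 : 0 < M^-1 by rewrite invr_gt0 (lt_le_trans _ M1).
have M0 : 0 <= M by exact: le_trans M1.
have vp : 0 < M^-1 * p by exact: mulr_gt0.
pose del := M^-1 * p / 24.
have del0 : 0 < del by rewrite divr_gt0.
have [L L0 eL] := e_ui del0.
pose C1 := 3 * K ^+ 2 + 3 * L.
pose C2 := (K ^+ 2 + 1) / (M^-1 / 4) + 3.
have C10 : 0 <= C1 by apply: addr_ge0; apply: mulr_ge0; rewrite ?sqr_ge0.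
have C20 : 0 <= C2.
  by apply: addr_ge0 => //; apply: divr_ge0; [rewrite addr_ge0 ?sqr_ge0|rewrite divr_ge0// ltW].
pose Q i := \int[P]_w N (q i.+1 w).
have Q0 i : 0 <= Q i by apply: Rintegral_ge0 => w _; exact: ip_ge0.
have QM n : \sum_(0 <= i < n) Q i <= M.
  have [I1 I2] := @Rintegral_sum _ _ _ P setT _ (index_iota 0 n)
    (fun i w => N (q i.+1 w)) measurableT (fun i => @int_q setT i measurableT).
  rewrite -I2; apply: (@le_trans _ _ (\int[P]_(w in setT) M)).
    by apply: le_Rintegral => //; exact: int_cst.
  by rewrite Rintegral_cst// ler_piMr// pr_le1.
have eta1 : 0 < M^-1 * p / 64 / (C1 + 1) by rewrite !divr_gt0// ltr_wpDl.
have eta2 : 0 < M^-1 * p / 64 / (C2 + 1) by rewrite !divr_gt0// ltr_wpDl.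
have [n1 pn] := pr_bigcap_cvg P (@mstay K) (@stayS K) eta1.
have [n2 Qn] := bounded_series_tail Q0 QM eta2.
have v8 : 0 < M^-1 / 8 by rewrite divr_gt0.
have [n3 sn] := s_o v8.
pose n := (n1 + n2 + n3)%N.
have nn1 : (n1 <= n)%N by rewrite /n -addnA leq_addr.
have nn2 : (n2 <= n)%N by rewrite /n addnAC leq_addl.
have nn3 : (n3 <= n)%N by rewrite leq_addl.
pose pk k := pr P (stay K k).
pose x k := \int[P]_(w in stay K k) N (X k w).
have ppk k : p <= pk k.
  by apply: le_pr => //; [exact: bigcapT_measurable|exact: bigcap_inf].
have x0 k : 0 <= x k by apply: Rintegral_ge0 => w _; exact: ip_ge0.
have sum_c m : \sum_(n <= i < (n + m)%N) c i.+1 ^+ 2 = a2 n - a2 (n + m)%N.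
  elim: m => [|m IH]; first by rewrite addn0 big_geq ?leqnn// subrr.
  by rewrite addnS big_nat_recr ?leq_addr//= IH (a2S (n + m)); lra.
have grow m : M^-1 / 4 * p * (a2 n - a2 (n + m)%N) <=
    x (n + m)%N + a2 n * (C1 * (pk n - pk (n + m)%N)
      + C2 * \sum_(n <= i < (n + m)%N) Q i) + 3 * del * (a2 n - a2 (n + m)%N).
  rewrite -sum_c; elim: m => [|m IH].
    by rewrite addn0 !big_geq ?leqnn// subrr !mulr0 !addr0 mulr0 addr0.
  rewrite addnS !big_nat_recr ?leq_addr//=.
  have snm : s (n + m).+1 <= M^-1 / 8 * c (n + m).+1 ^+ 2.
    by apply: sn; rewrite (leq_trans nn3)// leq_addr.
  have := growth_integral_step K (leq_addr m n) snm del0 L0 (eL _).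
  rewrite -/(x _) -/(x _) -/(pk _) -/(pk _) -/(Q _) -/C1 -/C2.
  have : M^-1 / 4 * c (n + m).+1 ^+ 2 * p <= M^-1 / 4 * c (n + m).+1 ^+ 2 * pk (n + m)%N.
    by apply: ler_wpM2l => //; rewrite mulr_ge0 ?sqr_ge0// divr_ge0// ltW.
  by move: IH; lra.
have xle J : x J <= (K ^+ 2 + M) * a2 J.
  have K2 : 0 <= (K ^+ 2 + M) * a2 J.
    by rewrite mulr_ge0 ?ltW// ltr_wpDl ?sqr_ge0// (lt_le_trans _ M1).
  apply: (@le_trans _ _ (\int[P]_(w in stay K J) ((K ^+ 2 + M) * a2 J))).
    have XB w : stay K J w -> N (X J w) <= (K ^+ 2 + M) * a2 J.
      move=> [gw /(_ J (leqnn J)) Yw]; apply: le_trans (XY gw) _.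
      rewrite mulrDl; apply: lerD => //; apply: le_trans (sM J) _.
      by apply: ler_wpM2l => //; exact: c_le_a2.
    have iC := int_cst ((K ^+ 2 + M) * a2 J) (mstay K J).
    apply: le_Rintegral => //.
    apply: (le_integrable_real (mstay K J) (mN (@mX J)) _ iC) => w Sw.
    by rewrite ger0_norm ?ip_ge0//; exact: XB.
  by rewrite Rintegral_cst// ler_piMr// pr_le1.
have bound : 0 < K ^+ 2 + M + M^-1 * p.
  by rewrite ltr_wpDl// addr_ge0 ?sqr_ge0.
have target : 0 < M^-1 * p / 32 * a2 n / (K ^+ 2 + M + M^-1 * p).
  by rewrite !divr_gt0// mulr_gt0// divr_gt0.
have [J0 aJ0] := a2_cvg0 target.
have aJ : a2 (n + J0)%N < M^-1 * p / 32 * a2 n / (K ^+ 2 + M + M^-1 * p).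
  by apply: le_lt_trans aJ0; apply: a2_anti; exact: leq_addl.
move: aJ; rewrite ltr_pdivlMr// => aJ.
have := grow J0; have := xle (n + J0)%N.
have := ppk (n + J0)%N; have := pn n nn1; have := Qn n J0 nn2.
have := a2_gt0 n; have := a2_gt0 (n + J0)%N.
move: aJ; rewrite -/(pk n) -/p /del.
set aJ := a2 (n + J0)%N; set an := a2 n; set pJ := pk (n + J0)%N.
set SQ := \sum_(_ <= _ < _) _; set xJ := x _; set pn' := pk n.
rewrite ler_pdivlMr ?ltr_wpDl// => h1 aJ0' an0 h2 h3 h4 h5 h6.
have h3' : C1 * (pn' - pJ) <= M^-1 * p / 64.
  apply: (@le_trans _ _ (C1 * (M^-1 * p / 64 / (C1 + 1)))).
    by apply: ler_wpM2l => //; lra.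
  rewrite mulrA ler_pdivrMr ?ltr_wpDl// mulrC.
  by apply: ler_wpM2l; [rewrite divr_ge0// ltW|rewrite lerDl].
have SQ0 : 0 <= SQ by apply: sumr_ge0.
have h2' : C2 * SQ <= M^-1 * p / 64 by move: h2 SQ0; lra.
have h7 : an * (C1 * (pn' - pJ) + C2 * SQ) <= an * (M^-1 * p / 32).
  by apply: ler_wpM2l; [exact: ltW|lra].
have h8 : 0 < an * (M^-1 * p) by exact: mulr_gt0.
have h9 : 0 < aJ * (M^-1 * p) by exact: mulr_gt0.
move: h1 h5 h6 h7 h8 h9; set vpp := M^-1 * p.
have -> : M^-1 / 4 * p = vpp / 4 by rewrite /vpp; ring.
by lra.
Qed.

Lemma null_of_cvg0 D : measurable D ->
  (forall w, D w -> (forall n, good n w) /\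
    forall eta : R, 0 < eta -> exists m, forall n, (m <= n)%N -> N (X n w) <= eta) ->
  pr P D = 0.
Proof.
move=> mD Dlim.
have [C C0 noret] := no_return.
have exits K : 1 <= K -> 16 * M <= K ^+ 2 -> pr P D <= C / K.
  move=> K1 KM; have K0 : 0 < K by exact: lt_le_trans K1.
  pose H k := if k is k'.+1 then
    (stay K k' `&` good k'.+1) `\` stay K k'.+1 else good 0%N `\` stay K 0%N.
  have FH k : F k (H k).
    have FD A B : F k A -> F k B -> F k (A `\` B).
      by rewrite !(measurable_sub _ (F_sa k)); exact: measurableD.
    case: k FD => [|k] FD /=; apply: FD => //; try exact: F_stay.
    by apply: F_setI => //; apply: F_mono (F_stay K k).
  have mH k := F_sub (FH k).
  have Hg k : H k `<=` good k by case: k => [|k] w [] // [].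
  have HY k w : H k w -> K ^+ 2 * a2 k <= N (Y k w).
    move=> Hw; rewrite leNgt; apply/negP => /ltW Yw; have := Hg _ _ Hw.
    case: k Hw Yw => [|k] [].
      move=> _ nS Yw gw; apply: nS; split => // j.
      by rewrite leqn0 => /eqP ->.
    move=> [[_ sw] _] nS Yw gw; apply: nS; split => // j.
    by rewrite leq_eqVlt ltnS => /predU1P[->//|]; exact: sw.
  have DHk k : pr P (D `&` H k) <= C / K * pr P (H k).
    apply: (noret K k (H k)) => //.
    - exact: HY.
    - exact: measurableI.
    - by move=> w [Dw _]; exact: Dlim.
  have CK : 0 <= C / K by rewrite divr_ge0// ltW.
  have mDS J : measurable (D `&` stay K J) by exact: measurableI.
  have split J : pr P D <= pr P (D `&` stay K J) + C / K * (1 - pr P (stay K J)).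
    have step A (k : nat) : measurable A -> D `&` stay K k `<=` A ->
        A `&` D `\` stay K k `<=` H k -> H k `<=` A ->
        stay K k `<=` A -> 
        pr P (A `&` D) <= pr P (D `&` stay K k) + C / K * (pr P A - pr P (stay K k)).
      move=> mA SA AH HA kA.
      have mAD : measurable (A `&` D) by exact: measurableI.
      rewrite (pr_setID P mAD (mDS k)); last by move=> w Dw; split; [exact: SA|case: Dw].
      rewrite lerD2l; apply: (@le_trans _ _ (pr P (D `&` H k))).
        apply: le_pr; [exact: measurableD|exact: measurableI|].
        move=> w [[Aw Dw] nDS]; split => //; apply: AH; split => // Sw; exact: nDS.
      apply: le_trans (DHk k) _; apply: ler_wpM2l => //.
      rewrite (pr_setID P mA (mstay K k) kA) addrC addKr.
      apply: le_pr => //; first exact: measurableD.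
      move=> w Hw; split; first exact: HA.
      by case: k Hw {SA AH HA kA} => [|k] [].
    elim: J => [|J IH].
      apply: (@le_trans _ _ (pr P (setT `&` D))); first by rewrite setTI.
      have pT : pr P setT = 1 by rewrite /pr probability_setT.
      rewrite -{1}pT; apply: step => //.
      by move=> w [[_ Dw] nS]; split => //; exact: (Dlim w Dw).1.
    apply: le_trans IH _.
    have : pr P (stay K J `&` D) <= pr P (D `&` stay K J.+1) +
        C / K * (pr P (stay K J) - pr P (stay K J.+1)).
      apply: step => //.
      - by move=> w [_ /stayS].
      - by move=> w [[Sw Dw] nS]; split => //; split => //; exact: (Dlim w Dw).1.
      - by move=> w [[]].
    by rewrite setIC; lra.
  apply/ler_addgt0Pr => eta eta0.
  have [n /(_ n (leqnn n))] := pr_bigcap_cvg P (@mstay K) (@stayS K) eta0.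
  rewrite stay_null add0r => Sn; apply: le_trans (split n) _.
  rewrite addrC; apply: lerD.
    by rewrite ler_piMr// lerBlDr lerDl pr_ge0.
  by apply: le_trans Sn; apply: le_pr => // w [].
have p0 := pr_ge0 P D.
apply/eqP; rewrite eq_le p0 andbT leNgt; apply/negP => pp.
have Cp : 0 < C / pr P D by exact: divr_gt0.
have M0 : 0 < M by exact: lt_le_trans M1.
pose K := 1 + 16 * M + C / pr P D.
have K1 : 1 <= K by rewrite /K; lra.
have KM : 16 * M <= K ^+ 2.
  by apply: (@le_trans _ _ K); rewrite ?expr2 ?ler_peMl// /K; lra.
have := exits K K1 KM; rewrite leNgt => /negP; apply.
rewrite ltr_pdivrMr ?(lt_le_trans ltr01)// mulrC -ltr_pdivrMr// /K.
by lra.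
Qed.

End LinearlyRepelledChain.

Section Repulsion.
Context {R : realType} {d : nat} (ip : {dot 'rV[R]_d for (idfun : R -> R)}).
Implicit Types (x g h : 'rV[R]_d).

Lemma powR_sq (t p : R) : 0 <= t -> (t `^ p) ^+ 2 = t `^ (2 * p).
Proof. by move=> t0; rewrite -powR_mulrn ?powR_ge0// -powRrM mulrC. Qed.

Lemma repelled_norm x g h (gam beta nu M : R) :
  0 <= gam -> 0 < beta -> 2^-1 < nu -> beta * ip x x <= ip g x ->
  ip h h <= M ^+ 2 * (gam `^ (1 + nu)) ^+ 2 ->
  ip x x <= ip (x + gam *: g + h) (x + gam *: g + h)
            + M ^+ 2 / (2 * beta) * gam `^ (1 + 2 * nu).
Proof.
move=> g0 b0 nu2 xg hh.
move: g0; rewrite le_eqVlt => /predU1P[gam0|g0].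
  move: hh; rewrite -gam0 scale0r addr0 powR0; last by rewrite gt_eqF//; lra.
  rewrite expr0n mulr0 => hh.
  have -> : h = 0 by apply: (@ip_eq0 _ _ ip); apply/eqP; rewrite eq_le hh ip_ge0.
  rewrite addr0 powR0 ?mulr0 ?addr0//; rewrite gt_eqF//; lra.
pose y := x + gam *: g; pose a := 2 * beta * gam.
have a0 : 0 < a by rewrite !mulr_gt0.
have yx : (1 + a) * ip x x <= ip y y.
  rewrite /y ipDD !(ipZr, ipZl) (ipC _ x g).
  have := ip_ge0 ip g => gg; have : 0 <= gam * (gam * ip g g) by rewrite !mulr_ge0// ltW.
  have : gam * (beta * ip x x) <= gam * ip g x by rewrite ler_pM2l.
  by rewrite /a; lra.
have yh : ip y y <= (1 + a) * (ip (y + h) (y + h) + ip h h / a).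
  have E0 := ip_ge0 ip (a *: y + (1 + a) *: h).
  rewrite ipDD !(ipZr, ipZl) in E0; rewrite ipDD -subr_ge0.
  set E := (X in 0 <= X) in E0.
  rewrite (_ : _ - _ = E / a); first by rewrite divr_ge0// ltW.
  by rewrite /E; field; rewrite gt_eqF.
have : ip x x <= ip (y + h) (y + h) + ip h h / a.
  by rewrite -(ler_pM2l (_ : 0 < 1 + a)) ?addr_gt0//; exact: le_trans yx yh.
move=> /le_trans; apply; rewrite lerD2l ler_pdivrMr//.
apply: le_trans hh _; rewrite powR_sq ?(ltW g0)//.
rewrite (_ : 2 * (1 + nu) = (1 + 2 * nu) + 1); last by ring.
rewrite powRD ?(gt_eqF g0) ?implybT// powRr1 ?(ltW g0)// /a.
rewrite le_eqVlt; apply/orP; left; apply/eqP.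
by field; rewrite gt_eqF.
Qed.

Lemma powR_split_le (t nu : R) : 0 <= t -> t <= 1 -> 2^-1 < nu ->
  t `^ (1 + 2 * nu) <= t ^+ 2 * t `^ (2 * nu - 1).
Proof.
move=> t0 t1 nu2; move: t0; rewrite le_eqVlt => /predU1P[<-|t0].
  by rewrite powR0 ?expr0n ?mul0r// gt_eqF//; lra.
rewrite -powR_mulrn ?(ltW t0)// -powRD ?(gt_eqF t0) ?implybT//.
by rewrite (_ : 2 + (2 * nu - 1) = 1 + 2 * nu)//; ring.
Qed.

Lemma sqr_le_powR (t L a : R) : 0 <= t -> 0 < L -> 2 < a ->
  t ^+ 2 <= L ^+ 2 + (L `^ (a - 2))^-1 * t `^ a.
Proof.
move=> t0 L0 a2.
have [tL|Lt] := leP t L.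
  apply: (@le_trans _ _ (L ^+ 2)); first by rewrite ler_pXn2r ?nnegrE// ltW.
  by rewrite lerDl mulr_ge0 ?invr_ge0 ?powR_ge0.
have tp : 0 < t by exact: lt_trans Lt.
apply: (@le_trans _ _ ((L `^ (a - 2))^-1 * t `^ a)); last by rewrite lerDr sqr_ge0.
rewrite mulrC ler_pdivlMr ?powR_gt0//.
rewrite (_ : t `^ a = t ^+ 2 * t `^ (a - 2)); last first.
  by rewrite -powR_mulrn// -powRD ?(gt_eqF tp) ?implybT// addrC subrK.
apply: ler_wpM2l; first exact: sqr_ge0.
by apply: ge0_ler_powR; rewrite ?nnegrE ?subr_ge0 ltW.
Qed.

End Repulsion.

Section Localization.
Context {R : realType} {d : nat} (ip : {dot 'rV[R]_d for (idfun : R -> R)})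
  {disp : measure_display} {T : measurableType disp} (P : probability T R)
  (F : nat -> set (set T)) (gamma c : nat -> R)
  (X G eps r1 r2 : nat -> T -> 'rV[R]_d) (V W : nat -> T -> \bar R)
  (a beta nu : R).
Local Notation N x := (ip x x).
Hypotheses
  (hF : filtration F)
  (gamma_ge0 : forall n, 0 <= gamma n)
  (c_io : forall N, exists2 n, (N <= n)%N & c n != 0)
  (c_sq : cvgn (series (fun n => c n ^+ 2)))
  (hX : adapted F X) (hG : adapted F G) (heps : adapted F eps)
  (hr1 : adapted F r1) (hr2 : predictable F r2)
  (eps_mean : forall n, is_cond_exp_rV P (F n) (eps n.+1) (cst 0))
  (V_def : forall n, is_cond_exp_ge0 P (F n)
             (fun w => (dot_norm ip (eps n.+1 w) ^+ 2)%:E) (V n))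
  (W_def : forall n, is_cond_exp_ge0 P (F n)
             (fun w => (dot_norm ip (eps n.+1 w) `^ a)%:E) (W n))
  (X_rec : forall n w, X n.+1 w - X n w =
     gamma n.+1 *: G n w + c n.+1 *: (eps n.+1 w + (r1 n.+1 w + r2 n.+1 w)))
  (ha : 2 < a) (hbeta : 0 < beta) (hnu : 2^-1 < nu).

Let tail2 k := limn (series (fun n => c n ^+ 2)) - series (fun n => c n ^+ 2) k.+1.

Let sq_nd : nondecreasing_seq (series (fun n => c n ^+ 2)).
Proof.
apply/nondecreasing_seqP => n.
by rewrite /series/= big_nat_recr//= lerDl sqr_ge0.
Qed.

Let tail2S k : tail2 k = c k.+1 ^+ 2 + tail2 k.+1.
Proof. by rewrite /tail2 /series/= (big_nat_recr k.+1)//=; ring. Qed.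

Let tail2_gt0 k : 0 < tail2 k.
Proof.
have [n kn cn] := c_io k.+1.
rewrite subr_gt0; apply: (@lt_le_trans _ _ (series (fun n => c n ^+ 2) n.+1)).
  apply: (@le_lt_trans _ _ (series (fun n => c n ^+ 2) n)); first exact: sq_nd.
  by rewrite /series/= big_nat_recr//= ltrDl lt_neqAle sqr_ge0 eq_sym sqrf_eq0 cn.
exact: nondecreasing_cvgn_le.
Qed.

Let tail2_cvg0 eta : 0 < eta -> exists k, tail2 k < eta.
Proof.
move=> eta0; have /cvgrPdist_lt/(_ _ eta0)[k _ Hk] := c_sq.
exists k; have := Hk k.+1 (leqnSn k).
by rewrite /= ltr_norml => /andP[_].
Qed.

Let rsum n0 n w := \sum_(n0 <= i < n.+1) N (r1 i w).

Definition local_conditions (M : R) n0 n w :=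
  [/\ ((M^-1)%:E <= V n w)%E, (W n w <= M%:E)%E,
      beta * N (X n w) <= ip (G n w) (X n w),
      \sum_(n0 <= i < n.+1) N (r1 i w) <= M &
      N (c n.+1 *: r2 n.+1 w) <= M ^+ 2 * (gamma n.+1 `^ (1 + nu)) ^+ 2].

Let F_sa k : sigma_algebra setT (F k). Proof. by case: hF => H _ _; exact: H. Qed.

Let F_sub k : F k `<=` measurable. Proof. by case: hF => _ H _; exact: H. Qed.

Let F_mono m n : (m <= n)%N -> F m `<=` F n.
Proof. by case: hF => _ _ H; exact: H. Qed.

Let F_setI k A B : F k A -> F k B -> F k (A `&` B).
Proof. by rewrite !(measurable_sub _ (F_sa k)); exact: measurableI. Qed.

Let F_le k (f g : T -> R) :
  measurable_fun setT (f : g_sigma_algebraType (F k) -> R) ->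
  measurable_fun setT (g : g_sigma_algebraType (F k) -> R) ->
  F k [set w | f w <= g w].
Proof.
move=> mf mg; rewrite (measurable_sub _ (F_sa k)) -[X in measurable X]setTI.
exact: measurable_fun_le.
Qed.

Let mono_coord m n (Z : T -> 'rV[R]_d) : (m <= n)%N ->
  coord_mfun (Z : g_sigma_algebraType (F m) -> 'rV[R]_d) ->
  coord_mfun (Z : g_sigma_algebraType (F n) -> 'rV[R]_d).
Proof. by move=> mn mZ i; exact: measurable_fun_subS (F_mono mn) (mZ i). Qed.

Let mrsum n0 k :
  measurable_fun setT (rsum n0 k : g_sigma_algebraType (F k) -> R).
Proof.
have -> : rsum n0 k = (fun w => \sum_(i <- index_iota n0 k.+1) N (r1 (minn i k) w)).
  apply/funext => w; rewrite /rsum !big_nat; apply: eq_bigr => i /andP[_ ik].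
  by rewrite (minn_idPl _).
apply: measurable_sum => i.
apply: measurable_ip; apply: (@mono_coord (minn i k)); rewrite ?geq_minr//;
  exact: borel_coord_mfun.
Qed.

Lemma F_local_conditions M n0 k : F k [set w | local_conditions M n0 k w].
Proof.
have FV : F k [set w | ((M^-1)%:E <= V k w)%E].
  have [_ /(_ `[(M^-1)%:E, +oo[%classic) + _] := V_def k.
  rewrite (_ : V k @^-1` _ = [set w | ((M^-1)%:E <= V k w)%E]); last first.
    by apply/seteqP; split => w /=; rewrite in_itv/= andbT.
  by apply; exact: emeasurable_itv.
have FW : F k [set w | (W k w <= M%:E)%E].
  have [_ /(_ `]-oo, M%:E]%classic) + _] := W_def k.
  rewrite (_ : W k @^-1` _ = [set w | (W k w <= M%:E)%E]); last first.
    by apply/seteqP; split => w /=; rewrite in_itv/=.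
  by apply; exact: emeasurable_itv.
have mXk := borel_coord_mfun (hX k); have mGk := borel_coord_mfun (hG k).
have mr2 := borel_coord_mfun (hr2 k).
have FG : F k [set w | beta * N (X k w) <= ip (G k w) (X k w)].
  apply: F_le; last exact: measurable_ip.
  by apply: measurable_funM => //; exact: measurable_ip.
have Fr : F k [set w | \sum_(n0 <= i < k.+1) N (r1 i w) <= M].
  by apply: F_le; [exact: mrsum|exact: measurable_cst].
have F2 : F k [set w | N (c k.+1 *: r2 k.+1 w) <= M ^+ 2 * (gamma k.+1 `^ (1 + nu)) ^+ 2].
  apply: F_le; last exact: measurable_cst.
  by apply: measurable_ip; apply: coord_mfunZ => //; exact: measurable_cst.
have := F_setI (F_setI (F_setI (F_setI FV FW) FG) Fr) F2.
by congr (F k _); apply/seteqP; split => w /= => [[[[[]]]]|[]].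
Qed.

Let good M n0 k : set T :=
  [set w | forall j, (j <= k)%N -> local_conditions M n0 (j + n0) w].

Let goodP M n0 k w : good M n0 k w -> local_conditions M n0 (k + n0) w.
Proof. exact. Qed.

Let F_good M n0 k : F (k + n0)%N (good M n0 k).
Proof.
elim: k => [|k IH].
  rewrite (_ : good M n0 0 = [set w | local_conditions M n0 (0 + n0) w]).
    exact: F_local_conditions.
  apply/seteqP; split => w /=; first exact: goodP.
  by move=> Lw j; rewrite leqn0 => /eqP ->.
rewrite (_ : good M n0 k.+1 = good M n0 k `&` [set w | local_conditions M n0 (k.+1 + n0) w]).
  apply: F_setI; last exact: F_local_conditions.
  by apply: F_mono IH; rewrite leq_add2r.
apply/seteqP; split => w.
  by move=> gw; split; [move=> j /leqW; exact: gw|exact: goodP].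
by move=> [gw Lw] j; rewrite leq_eqVlt ltnS => /predU1P[->//|]; exact: gw.
Qed.

Let mN2 k : measurable_fun setT (fun w => N (eps k w)).
Proof.
apply: measurable_ip => i;
  exact: (measurable_fun_sub (@F_sub k) (borel_coord_mfun (heps k) i)).
Qed.

Let mNa k : measurable_fun setT (fun w => dot_norm ip (eps k w) `^ a).
Proof.
apply: (measurableT_comp (measurable_powR _)).
exact: (measurableT_comp (continuous_measurable_fun (@sqrt_continuous R)) (mN2 k)).
Qed.

Let int_a M k A : F k A -> 0 <= M -> (forall w, A w -> (W k w <= M%:E)%E) ->
  P.-integrable A (EFin \o (fun w => dot_norm ip (eps k.+1 w) `^ a)) /\
  \int[P]_(w in A) (dot_norm ip (eps k.+1 w) `^ a) <= M * pr P A.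
Proof.
move=> FA M0 WM; have mA := F_sub FA.
have [W0 mW WE] := W_def k.
have intW : (\int[P]_(w in A) (dot_norm ip (eps k.+1 w) `^ a)%:E <= (M * pr P A)%:E)%E.
  rewrite -WE// EFinM -prE// -integral_cst//.
  apply: ge0_le_integral => //.
  by apply: measurable_funTS; exact: (measurable_fun_sub (@F_sub k) (measurable_wrt_fun mW)).
split.
  apply/integrableP; split.
    by apply/measurable_EFinP; exact: measurable_funTS.
  apply: le_lt_trans (ltry (M * pr P A)); apply: le_trans intW.
  by apply: ge0_le_integral => //= [||w _];
    rewrite ?ger0_norm ?powR_ge0//; apply/measurable_EFinP; [
    apply: measurableT_comp|]; exact: measurable_funTS.
rewrite -lee_fin /Rintegral fineK// ge0_fin_numE; last by apply: integral_ge0 => w _; rewrite lee_fin powR_ge0.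
exact: le_lt_trans intW (ltry _).
Qed.

Let int_N2 M k : F k [set w | (W k w <= M%:E)%E] -> 0 <= M ->
  P.-integrable [set w | (W k w <= M%:E)%E] (EFin \o (fun w => N (eps k.+1 w))).
Proof.
move=> FA M0; have [ia _] := int_a FA M0 (fun w => id).
have mA := F_sub FA.
have i1 : P.-integrable [set w | (W k w <= M%:E)%E] (EFin \o cst 1).
  exact: finite_measure_integrable_cst.
apply: (le_integrable_real mA (@mN2 k.+1) _ (integrableD mA i1 ia)) => w _ /=.
rewrite ger0_norm ?ip_ge0// -dot_norm_sq.
have := sqr_le_powR (dot_norm_ge0 ip (eps k.+1 w)) ltr01 ha.
by rewrite expr1n powR1 invr1 mul1r.
Qed.

Let N2_lower M k A : F k A -> 0 < M ->
  (forall w, A w -> ((M^-1)%:E <= V k w)%E) ->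
  P.-integrable A (EFin \o (fun w => N (eps k.+1 w))) ->
  M^-1 * pr P A <= \int[P]_(w in A) N (eps k.+1 w).
Proof.
move=> FA M0 VM iA; have mA := F_sub FA.
have [V0 mV VE] := V_def k.
rewrite -lee_fin /Rintegral fineK; last exact: integrable_fin_num.
under eq_integral do rewrite -dot_norm_sq.
rewrite -VE// EFinM -prE// -integral_cst//.
apply: ge0_le_integral => //.
- by move=> w _; rewrite lee_fin invr_ge0 ltW.
- by apply: measurable_funTS; exact: (measurable_fun_sub (@F_sub k) (measurable_wrt_fun mV)).
Qed.

Let N2_upper M k A B L : F k A -> 0 <= M -> 0 < L ->
  (forall w, A w -> (W k w <= M%:E)%E) -> measurable B -> B `<=` A ->
  P.-integrable A (EFin \o (fun w => N (eps k.+1 w))) ->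
  \int[P]_(w in B) N (eps k.+1 w) <=
    L ^+ 2 * pr P B + M / L `^ (a - 2) * pr P A.
Proof.
move=> FA M0 L0 WM mB BA iA; have mA := F_sub FA.
have [ia aM] := int_a FA M0 WM.
have iaB := integrableS mA mB BA ia.
have iZ := integrableZl mB (L `^ (a - 2))^-1 iaB.
have iC : P.-integrable B (EFin \o cst (L ^+ 2)) by exact: finite_measure_integrable_cst.
apply: (@le_trans _ _ (\int[P]_(w in B)
    (L ^+ 2 + (L `^ (a - 2))^-1 * dot_norm ip (eps k.+1 w) `^ a))).
  apply: le_Rintegral => //.
  - exact: integrableS mA mB BA iA.
  - exact: (integrableD mB iC iZ).
  - by move=> w _; rewrite -dot_norm_sq; apply: sqr_le_powR => //; exact: dot_norm_ge0.
rewrite RintegralD// Rintegral_cst// lerD2l (RintegralZl _ mB iaB).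
rewrite mulrAC [leRHS]mulrC; apply: ler_wpM2l; first by rewrite invr_ge0 powR_ge0.
apply: le_trans aM; apply: le_Rintegral_subset => // w _; exact: powR_ge0.
Qed.

(* [good M n0 k] bounds the square sum of [r1] only up to time [k], so the step
   from [k] to [k + 1] needs [r1] cut off where that bound fails. *)
Let q n0 M n w : 'rV[R]_d := \1_[set w | rsum n0 n w <= M] w *: r1 n w.

Let q_sum n0 M n w : 0 <= M -> \sum_(0 <= i < n) N (q n0 M (i.+1 + n0) w) <= M.
Proof.
move=> M0.
suff [] : \sum_(0 <= i < n) N (q n0 M (i.+1 + n0) w) <= M /\
  \sum_(0 <= i < n) N (q n0 M (i.+1 + n0) w) <= rsum n0 (n + n0) w by [].
elim: n => [|n [IH1 IH2]].
  by rewrite big_nil; split => //; apply: sumr_ge0 => i _; exact: ip_ge0.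
have rS : rsum n0 (n.+1 + n0) w = rsum n0 (n + n0) w + N (r1 (n.+1 + n0)%N w).
  by rewrite /rsum addSn big_nat_recr//= leqW// leq_addl.
rewrite big_nat_recr//=; have [rM|rM] := leP (rsum n0 (n.+1 + n0) w) M.
  have -> : q n0 M (n.+1 + n0) w = r1 (n.+1 + n0)%N w.
    by rewrite /q indicE mem_set//= scale1r.
  by move: rM; rewrite rS => rM; split; lra.
have -> : q n0 M (n.+1 + n0) w = 0.
  rewrite /q indicE memNset/= ?scale0r//; apply/negP; by rewrite -ltNge.
rewrite ip0r addr0; split => //; apply: le_trans IH2 _.
by rewrite rS lerDl ip_ge0.
Qed.

Let nu_gt0 : 0 < 2 * nu - 1. Proof. by rewrite subr_gt0 mulrC -ltr_pdivrMr// mul1r. Qed.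

Lemma localized_null M n0 D : 1 <= M ->
  (forall n, (n0 <= n)%N -> gamma n <= M * c n /\ gamma n <= 1) ->
  (forall eta, 0 < eta -> exists n, forall k, (n <= k)%N -> gamma k <= eta) ->
  measurable D ->
  (forall w, D w -> (forall n, (n0 <= n)%N -> local_conditions M n0 n w) /\
    (forall eta, 0 < eta ->
      exists m, forall n, (m <= n)%N -> N (X n w) <= eta)) ->
  pr P D = 0.
Proof.
move=> M1 gMc gamma0 mD Dlim.
have M0 : 0 < M by exact: lt_le_trans M1.
have FW k : F k [set w | (W k w <= M%:E)%E].
  have [_ /(_ `]-oo, M%:E]%classic) + _] := W_def k.
  rewrite (_ : W k @^-1` _ = [set w | (W k w <= M%:E)%E]); last first.
    by apply/seteqP; split => w /=; rewrite in_itv/=.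
  by apply; exact: emeasurable_itv.
pose kap := M ^+ 2 / (2 * beta).
have kap0 : 0 <= kap by rewrite divr_ge0 ?sqr_ge0 ?mulr_ge0// ltW.
pose M' := M + kap * M ^+ 2.
have MM' : M <= M' by rewrite lerDl mulr_ge0 ?sqr_ge0.
have sle n : (n0 <= n)%N -> kap * gamma n `^ (1 + 2 * nu) <=
    kap * M ^+ 2 * c n ^+ 2 * gamma n `^ (2 * nu - 1).
  move=> /gMc[gc g1].
  rewrite [leRHS](_ : _ = kap * (M ^+ 2 * c n ^+ 2 * gamma n `^ (2 * nu - 1))); last by ring.
  apply: ler_wpM2l => //.
  apply: le_trans (powR_split_le (gamma_ge0 n) g1 hnu) _.
  apply: ler_wpM2r; first exact: powR_ge0.
  rewrite -exprMn ler_pXn2r ?nnegrE// (le_trans _ gc)//.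
have gpow1 n : (n0 <= n)%N -> gamma n `^ (2 * nu - 1) <= 1.
  move=> /gMc[_ g1]; apply: (@le_trans _ _ (1 `^ (2 * nu - 1))); last by rewrite powR1.
  by apply: ge0_ler_powR; rewrite ?nnegrE// ltW.
have gM n w : good M n0 n w -> forall j, (n0 <= j)%N -> (j <= n + n0)%N ->
    local_conditions M n0 j w.
  by move=> gw j n0j jn; rewrite -(subnK n0j); apply: gw; rewrite leq_subLR addnC.
apply: (@null_of_cvg0 R d ip disp T P (fun k => F (k + n0)%N)
  (fun k => c (k + n0)%N) (fun k => kap * gamma (k + n0)%N `^ (1 + 2 * nu))
  (fun k => tail2 (k + n0)%N) (fun k => X (k + n0)%N)
  (fun k w => X (k + n0)%N w + gamma (k + n0).+1 *: G (k + n0)%N w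
              + c (k + n0).+1 *: r2 (k + n0).+1 w)
  (fun k => eps (k + n0)%N) (fun k => q n0 M (k + n0)%N) (good M n0) M') => //.
- split=> [k|k|m n mn]; [exact: F_sa|exact: F_sub|].
  by apply: F_mono; rewrite leq_add2r.
- move=> eta /tail2_cvg0[k Hk]; exists k; apply: le_lt_trans Hk.
  rewrite /tail2 lerD2l lerN2; apply: sq_nd; by rewrite ltnS leq_addr.
- by move=> k; rewrite mulr_ge0// powR_ge0.
- move=> k; rewrite addSn; apply: le_trans (sle _ _) _; first by rewrite leqW// leq_addl.
  apply: (@le_trans _ _ (kap * M ^+ 2 * c (k + n0).+1 ^+ 2)).
    apply: ler_piMr; last by apply: gpow1; rewrite leqW// leq_addl.
    by apply: mulr_ge0; [apply: mulr_ge0|]; rewrite ?sqr_ge0.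
  by apply: ler_wpM2r; rewrite ?sqr_ge0// /M' lerDr ltW.
- move=> eta eta0.
  have den0 : 0 < kap * M ^+ 2 + 1 by rewrite ltr_wpDl// mulr_ge0// sqr_ge0.
  have e1 : 0 < eta / (kap * M ^+ 2 + 1) by exact: divr_gt0.
  set p := 2 * nu - 1 in sle gpow1; have p0 : 0 < p := nu_gt0.
  have [|n Hn] := gamma0 ((eta / (kap * M ^+ 2 + 1)) `^ p^-1); first exact: powR_gt0.
  exists n => k nk; rewrite addSn.
  have kn : (n <= (k + n0).+1)%N by rewrite leqW// (leq_trans nk)// leq_addr.
  apply: le_trans (sle _ _) _; first by rewrite leqW// leq_addl.
  have gp : gamma (k + n0).+1 `^ p <= eta / (kap * M ^+ 2 + 1).
    rewrite -[leRHS](powRr1 (ltW e1)) -[X in _ <= _ `^ X](mulVf (lt0r_neq0 p0)) powRrM.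
    by apply: ge0_ler_powR; rewrite ?nnegrE ?powR_ge0 ?(ltW p0)//; exact: Hn.
  rewrite mulrAC; apply: ler_wpM2r; first exact: sqr_ge0.
  apply: (@le_trans _ _ (kap * M ^+ 2 * (eta / (kap * M ^+ 2 + 1)))).
    by apply: ler_wpM2l => //; rewrite mulr_ge0 ?sqr_ge0.
  by rewrite mulrA ler_pdivrMr// mulrC ler_pM2l// lerDl.
- exact: le_trans M1 MM'.
- move=> k; exact: borel_coord_mfun (hX _).
- move=> k; apply: coord_mfunD; last first.
    apply: coord_mfunZ; first exact: measurable_cst.
    exact: borel_coord_mfun (hr2 _).
  apply: coord_mfunD; first exact: borel_coord_mfun (hX _).
  apply: coord_mfunZ; first exact: measurable_cst.
  exact: borel_coord_mfun (hG _).
- move=> k; exact: borel_coord_mfun (heps _).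
- move=> k; apply: coord_mfunZ; last exact: borel_coord_mfun (hr1 _).
  apply: measurable_indic; rewrite -measurable_sub//.
  by apply: F_le; [exact: mrsum|exact: measurable_cst].
- move=> k w gw j /leqW; exact: gw.
- move=> k w gw.
  have [_ _ _ rM _] := goodP gw.
  rewrite /q indicE mem_set//= scale1r -[LHS](subrK (X (k + n0)%N w)) addSn X_rec.
  rewrite -(addrC (X _ w)) -!addrA; congr (_ + (_ + _)).
  rewrite -scalerDr; congr (_ *: _).
  by rewrite [RHS]addrCA [in RHS](addrC (r2 _ _)).
- move=> k w gw; have [_ _ XG _ r2M] := goodP gw.
  rewrite addSn; exact: repelled_norm.
- move=> k; apply: (integrableS _ _ _ (int_N2 (FW (k + n0)%N) (ltW M0))) => //.
  + exact: F_sub (FW (k + n0)%N).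
  + exact: F_sub (@F_good M n0 k).
  + by move=> w gw; have [] := goodP gw.
- move=> k A FA Ag; apply: (@le_trans _ _ (M^-1 * pr P A)).
    by apply: ler_wpM2r; rewrite ?pr_ge0// lef_pV2 ?posrE// (lt_le_trans M0).
  rewrite addSn; apply: N2_lower => //.
    by move=> w /Ag gw; have [] := goodP gw.
  apply: (integrableS _ _ _ (int_N2 (FW (k + n0)%N) (ltW M0))) => //.
  + exact: F_sub (FW (k + n0)%N).
  + exact: F_sub FA.
  + by move=> w /Ag gw; have [] := goodP gw.
- move=> del del0; have a20 : 0 < a - 2 by rewrite subr_gt0.
  have B0 : 0 < M / del + 1 by rewrite addr_gt0// divr_gt0.
  pose L := (M / del + 1) `^ (a - 2)^-1.
  have LE : L `^ (a - 2) = M / del + 1.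
    by rewrite -powRrM mulVf ?gt_eqF// powRr1// ltW.
  exists (L ^+ 2); first exact: sqr_ge0.
  move=> k A B FA Ag mB BA; rewrite addSn.
  apply: (@le_trans _ _ (L ^+ 2 * pr P B + M / L `^ (a - 2) * pr P A)).
    apply: N2_upper => //; [exact: ltW|exact: powR_gt0| |].
      by move=> w /Ag gw; have [] := goodP gw.
    apply: (integrableS _ _ _ (int_N2 (FW (k + n0)%N) (ltW M0))) => //.
    + exact: F_sub (FW (k + n0)%N).
    + exact: F_sub FA.
    + by move=> w /Ag gw; have [] := goodP gw.
  rewrite lerD2l LE; apply: ler_wpM2r; first exact: pr_ge0.
  rewrite ler_pdivrMr// mulrDr mulrCA divff ?gt_eqF// mulr1 mulr1 lerDl; exact: ltW.
- by move=> n w; apply: le_trans MM'; exact: q_sum (ltW M0).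
- move=> w /Dlim[Lw Xw]; split.
    by move=> n j jn; apply: Lw; rewrite leq_addl.
  move=> eta /Xw[m Hm]; exists m => n mn; apply: Hm.
  by rewrite (leq_trans mn)// leq_addr.
Qed.

End Localization.

Section LimitBounds.
Context {R : realType}.

Lemma limn_esup_lt_eventually (u : nat -> \bar R) (l : \bar R) :
  (limn_esup u < l)%E ->
  exists2 y, (y < l)%E & exists n, forall k, (n <= k)%N -> (u k <= y)%E.
Proof.
move=> /ereal_inf_lt[_ [A [n _ nA] <-] Al].
exists (ereal_sup [set u x | x in A]) => //; exists n => k nk.
by apply: ereal_sup_ubound; exists k => //; exact: nA.
Qed.

Lemma limn_esup_lty_bounded (u : nat -> \bar R) : (limn_esup u < +oo)%E ->
  exists M : R, exists n, forall k, (n <= k)%N -> (u k <= M%:E)%E.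
Proof.
move=> /limn_esup_lt_eventually[[r| |] // _ [n Hn]].
  by exists r, n.
by exists 0, n => k /Hn; rewrite leeNy_eq => /eqP ->; exact: leNye.
Qed.

Lemma limn_einf_gt0_bounded (u : nat -> \bar R) : (0 < limn_einf u)%E ->
  exists2 v : R, 0 < v & exists n, forall k, (n <= k)%N -> (v%:E <= u k)%E.
Proof.
rewrite /limn_einf oppe_gt0 => /limn_esup_lt_eventually[[r| |] // r0 [n Hn]].
  exists (- r); first by rewrite oppr_gt0 -lte_fin.
  by exists n => k /Hn; rewrite leeNl.
exists 1 => //; exists n => k /Hn; rewrite leeNy_eq => /eqP uk.
by rewrite -(oppeK (u k)) uk leey.
Qed.

End LimitBounds.

Section NormEquivalence.
Context {R : realType} {d : nat} (ip : {dot 'rV[R]_d for (idfun : R -> R)}).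

Lemma cvg0_dotP (x : nat -> 'rV[R]_d) :
  x @ \oo --> (0 : 'rV[R]_d) <->
  forall eta, 0 < eta -> exists m, forall n, (m <= n)%N -> ip (x n) (x n) <= eta.
Proof.
pose g i j := ip (delta_mx ord0 i) (delta_mx ord0 j : 'rV[R]_d).
pose K2 := \sum_i \sum_j `|g j i|.
have K20 : 0 <= K2 by apply: sumr_ge0 => i _; exact: sumr_ge0.
have coord_le (y : 'rV[R]_d) i : `|y ord0 i| <= `|y|.
  rewrite [leRHS]/Num.norm/= mx_normrE.
  exact: (le_bigmax _ (fun ij : 'I_1 * 'I_d => `|y ij.1 ij.2|) (ord0, i)).
have ip_le y : ip y y <= K2 * `|y| ^+ 2.
  rewrite ip_sum mulr_suml; apply: ler_sum => i _.
  rewrite ipC ip_sum mulr_sumr mulr_suml; apply: ler_sum => j _.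
  apply: le_trans (ler_norm _) _; rewrite !normrM mulrA mulrC (ipC ip).
  apply: ler_wpM2l => //; rewrite expr2; apply: ler_pM => //; exact: coord_le.
have [K K0 le_ip] := ip_coord_bound ip.
split=> [/cvgr0Pnorm_le x0 eta eta0|x0].
  have e0 : 0 < Num.sqrt (eta / (K2 + 1)) by rewrite sqrtr_gt0 divr_gt0// ltr_wpDl.
  have [m _ Hm] := x0 _ e0; exists m => n /Hm /= xn.
  apply: le_trans (ip_le _) _.
  apply: (@le_trans _ _ (K2 * (eta / (K2 + 1)))).
    apply: ler_wpM2l => //; rewrite -[leRHS]sqr_sqrtr; last by rewrite divr_ge0 ?addr_ge0// ltW.
    by rewrite ler_pXn2r ?nnegrE// ltW.
  rewrite mulrA ler_pdivrMr ?ltr_wpDl// mulrC ler_pM2l// lerDl//.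
apply/cvgr0Pnorm_le => e e0.
have d0 : 0 < (e / (K + 1)) ^+ 2 by rewrite exprn_gt0// divr_gt0// ltr_wpDl.
have [m Hm] := x0 _ d0; exists m => // n /= /Hm xn.
have xd : dot_norm ip (x n) <= e / (K + 1).
  rewrite -(@ler_pXn2r _ 2) ?nnegrE ?dot_norm_ge0 ?divr_ge0 ?addr_ge0 ?(ltW e0)//.
  by rewrite dot_norm_sq.
have xe i : `|x n ord0 i| <= e.
  apply: le_trans (le_ip _ _) _; apply: (@le_trans _ _ (K * (e / (K + 1)))).
    exact: ler_wpM2l.
  by rewrite mulrA ler_pdivrMr ?ltr_wpDl// mulrC ler_pM2l// lerDl.
rewrite /Num.norm/= mx_normrE; apply: bigmax_le; first exact: ltW.
by move=> [i j] _; rewrite /= (ord1 i); exact: xe.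
Qed.

End NormEquivalence.

Unset Implicit Arguments.

Theorem proposition2p2p2
  (R : realType) (d : nat) (ip : {dot 'rV[R]_d for (idfun : R -> R)})
  (disp : measure_display) (T : measurableType disp) (P : probability T R)
  (F : nat -> set (set T)) (hF : filtration F)
  (gamma c : nat -> R)
  (gamma_ge0 : forall n, 0 <= gamma n) (c_ge0 : forall n, 0 <= c n)
  (c_io : forall N, exists2 n, (N <= n)%N & c n != 0)
  (c_sq : cvgn (series (fun n => c n ^+ 2)))
  (X G eps r r1 r2 : nat -> T -> 'rV[R]_d)
  (hX : adapted F X) (hG : adapted F G)
  (heps : adapted F eps) (hr : adapted F r)
  (V W : nat -> T -> \bar R) (a : R)
  (eps_mean : forall n, is_cond_exp_rV P (F n) (eps n.+1) (cst 0))
  (V_def : forall n, is_cond_exp_ge0 P (F n)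
             (fun w => (dot_norm ip (eps n.+1 w) ^+ 2)%:E) (V n))
  (V_fin : forall n, {ae P, forall w, (V n w < +oo)%E})
  (W_def : forall n, is_cond_exp_ge0 P (F n)
             (fun w => (dot_norm ip (eps n.+1 w) `^ a)%:E) (W n))
  (X_rec : forall n w, X n.+1 w - X n w =
             gamma n.+1 *: G n w + c n.+1 *: (eps n.+1 w + r n.+1 w))
  (Gamma : set T) (hGamma : measurable Gamma)
  (gamma_O : gamma =O_\oo c)
  (r_dec : forall n w, r n w = r1 n w + r2 n w)
  (hr1 : adapted F r1) (hr2 : predictable F r2)
  (T0 : {RV P >-> R}) (beta rho nu : R)
  (ha : 2 < a) (hbeta : 0 < beta) (hrho : 0 < rho) (hnu : 2^-1 < nu)
  (h : {ae P, forall w, Gamma w ->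
     [/\ (0 < limn_einf (V ^~ w))%E /\ (limn_esup (W ^~ w) < +oo)%E,
         forall n, T0 w <= n%:R -> dot_norm ip (X n w) < rho ->
           beta * dot_norm ip (X n w) ^+ 2 <= ip (G n w) (X n w),
         (\sum_(0 <= n <oo) (dot_norm ip (r1 n w) ^+ 2)%:E < +oo)%E &
         exists2 C : R, 0 < C & \forall n \near \oo,
           ((dot_norm ip (r2 n w))%:E
              <= C%:E * ediv (gamma n `^ (1 + nu)) (c n))%E]}) :
  P (Gamma `&` [set w | X ^~ w @ \oo --> (0 : 'rV[R]_d)]) = 0%E.
Proof.
have hF3 : forall k, F k `<=` measurable by case: hF.
have X_rec' n w : X n.+1 w - X n w =
    gamma n.+1 *: G n w + c n.+1 *: (eps n.+1 w + (r1 n.+1 w + r2 n.+1 w)).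
  by rewrite X_rec r_dec.
have cvgE : [set w | X ^~ w @ \oo --> (0 : 'rV[R]_d)] =
    \bigcap_p \bigcup_m \bigcap_(n in [set n | (m <= n)%N])
      [set w | ip (X n w) (X n w) <= p.+1%:R^-1].
  apply/seteqP; split => w /=.
    move=> /(cvg0_dotP ip) Xw p _; have [|m Hm] := Xw p.+1%:R^-1.
      by rewrite invr_gt0.
    by exists m => // n /= /Hm.
  move=> Xw; apply/(cvg0_dotP ip) => eta eta0.
  have [m _ Hm] := Xw (Num.bound eta^-1) I; exists m => n /Hm /= /le_trans; apply.
  rewrite invf_ple ?posrE//; apply: le_trans (ltW (archi_boundP _)) _.
    by rewrite invr_ge0 ltW.
  by rewrite ler_nat.
have mcvg : measurable [set w | X ^~ w @ \oo --> (0 : 'rV[R]_d)].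
  rewrite cvgE; apply: bigcapT_measurable => p; apply: bigcup_measurable => m _.
  apply: bigcap_measurableType => n _.
  rewrite -[X in measurable X]setTI; apply: measurable_fun_le => //.
  apply: measurable_ip => i;
    exact: (measurable_fun_sub (@hF3 n) (borel_coord_mfun (hX n) i)).
have [B B0 [N1 gB]] : exists2 B, 0 < B &
    exists N1, forall n, (N1 <= n)%N -> gamma n <= B * c n.
  have /eqO_exP[B B0 [N1 _ HN]] := gamma_O.
  exists B => //; exists N1 => n /HN /=.
  by rewrite !ger0_norm.
have c_cvg eta : 0 < eta -> exists n, forall k, (n <= k)%N -> c k <= eta.
  move=> eta0; have e2 : 0 < eta ^+ 2 by exact: exprn_gt0.
  have /cvgr0Pnorm_le/(_ _ e2)[n _ Hn] := cvg_series_cvg_0 c_sq.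
  exists n => k /Hn /=; rewrite ger0_norm ?sqr_ge0// ler_pXn2r// nnegrE//.
  exact: ltW.
have gamma_cvg eta : 0 < eta -> exists n, forall k, (n <= k)%N -> gamma k <= eta.
  move=> eta0; have [|n Hn] := c_cvg (eta / B); first exact: divr_gt0.
  exists (n + N1)%N => k nk; apply: le_trans (gB _ _) _.
    by apply: leq_trans nk; rewrite leq_addl.
  rewrite mulrC -ler_pdivlMr//; apply: Hn; apply: leq_trans nk; exact: leq_addr.
have [N2 g1] := gamma_cvg 1 ltr01.
pose M1 := (Num.bound B).+1.
have BM m : B <= (m + M1)%:R.
  apply: le_trans (ltW (archi_boundP (ltW B0))) _.
  by rewrite ler_nat /M1 addnS leqW// leq_addl.
pose n0 m := (m + N1 + N2)%N.
pose D m := (Gamma `&` [set w | X ^~ w @ \oo --> (0 : 'rV[R]_d)]) `&`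
  \bigcap_(n in [set n | (n0 m <= n)%N])
    [set w | local_conditions ip gamma c X G r1 r2 V W beta nu (m + M1)%:R (n0 m) n w].
have mD m : measurable (D m).
  apply: measurableI; first exact: measurableI.
  apply: bigcap_measurableType => n _; apply: (hF3 n).
  exact: (F_local_conditions gamma c beta nu hF hX hG hr1 hr2 V_def W_def).
have D0 m : pr P (D m) = 0.
  apply: (@localized_null R d ip disp T P F gamma c X G eps r1 r2 V W a beta nu
    hF gamma_ge0 c_io c_sq hX hG heps hr1 hr2 eps_mean V_def W_def X_rec' ha hbeta hnu
    (m + M1)%:R (n0 m)) => //.
  - by rewrite (_ : 1 = 1%:R)// ler_nat /M1 addnS.
  - move=> n mn; split; last first.
      by apply: g1; apply: leq_trans mn; rewrite leq_addl.
    apply: (@le_trans _ _ (B * c n)); last by apply: ler_wpM2r.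
    by apply: gB; apply: leq_trans mn; rewrite /n0 addnAC leq_addl.
  - move=> w [[_ Xw] Lw]; split; first exact: Lw.
    by apply/(cvg0_dotP ip).
have negD : P.-negligible (\bigcup_m D m).
  apply: negligible_bigcup => m; apply/(negligibleP _ (mD m)).
  by have := prE P (mD m); rewrite D0.
apply: measure_negligible; first exact: measurableI.
apply: (negligibleS _ (negligibleU h negD)).
move=> w [Gw Xw] /=.
case: (pselect (Gamma w ->
     [/\ (0 < limn_einf (V ^~ w))%E /\ (limn_esup (W ^~ w) < +oo)%E,
         forall n, T0 w <= n%:R -> dot_norm ip (X n w) < rho ->
           beta * dot_norm ip (X n w) ^+ 2 <= ip (G n w) (X n w),
         (\sum_(0 <= n <oo) (dot_norm ip (r1 n w) ^+ 2)%:E < +oo)%E &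
         exists2 C : R, 0 < C & \forall n \near \oo,
           ((dot_norm ip (r2 n w))%:E
              <= C%:E * ediv (gamma n `^ (1 + nu)) (c n))%E])) => [|Nw]; last by left.
move=> /(_ Gw)[[/limn_einf_gt0_bounded[v v0 [nV HV]] /limn_esup_lty_bounded[b [nW HW]]] HG Hr1].
move=> [C C0 [n2 _ H2]]; right.
have [nX HX] : exists n, forall k, (n <= k)%N -> dot_norm ip (X k w) < rho.
  have rho2 : 0 < (rho / 2) ^+ 2 by rewrite exprn_gt0// divr_gt0.
  have /(cvg0_dotP ip)/(_ _ rho2)[n Hn] := Xw.
  exists n => k /Hn; rewrite -dot_norm_sq ler_pXn2r ?nnegrE ?dot_norm_ge0 ?divr_ge0 ?(ltW hrho)//.
  by move=> /le_lt_trans; apply; rewrite ltr_pdivrMr// ltr_pMr// ltr1n.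
pose S := (\sum_(0 <= n <oo) (dot_norm ip (r1 n w) ^+ 2)%:E)%E.
have S0 : (0 <= S)%E by apply: nneseries_ge0 => n _ _; rewrite lee_fin sqr_ge0.
have Sfin : S = (fine S)%:E by rewrite fineK// ge0_fin_numE.
have natub (x : R) : exists k0 : nat, forall k, (k0 <= k)%N -> x <= k%:R.
  exists (Num.bound `|x|) => k xk; apply: le_trans (ler_norm x) _.
  by apply: le_trans (ltW (archi_boundP (normr_ge0 x))) _; rewrite ler_nat.
have [kv Hkv] := natub v^-1; have [kb Hkb] := natub b.
have [kT HkT] := natub (T0 w); have [kS HkS] := natub (fine S).
have [kC HkC] := natub C.
pose m := (nV + nW + nX + n2 + kv + kb + kT + kS + kC)%N.
exists m => //; split => // n /= mn.
have mM : (m <= m + M1)%N by exact: leq_addr.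
have mn' : (m <= n)%N by apply: leq_trans mn; rewrite /n0 -addnA leq_addr.
split.
- apply: le_trans (HV n _); last by apply: leq_trans mn'; rewrite /m -!addnA leq_addr.
  rewrite lee_fin -[leRHS]invrK lef_pV2 ?posrE ?invr_gt0//.
    by apply: Hkv; apply: leq_trans mM; rewrite /m; lia.
  by rewrite ltr0n addnS.
- apply: (@le_trans _ _ b%:E); first by apply: HW; apply: leq_trans mn'; rewrite /m; lia.
  by rewrite lee_fin; apply: Hkb; apply: leq_trans mM; rewrite /m; lia.
- rewrite -dot_norm_sq; apply: HG.
    by apply: HkT; apply: leq_trans mn'; rewrite /m; lia.
  by apply: HX; apply: leq_trans mn'; rewrite /m; lia.
- apply: (@le_trans _ _ (fine S)); last first.
    by apply: HkS; apply: leq_trans mM; rewrite /m; lia.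
  rewrite -lee_fin -Sfin.
  apply: le_trans (nneseries_lim_ge n.+1 _); last by move=> k _ _; rewrite lee_fin sqr_ge0.
  rewrite sumEFin lee_fin; under [leRHS]eq_bigr do rewrite dot_norm_sq.
  rewrite (@big_cat_nat _ _ _ (n0 m) 0 n.+1)//=; last exact: leqW.
  by rewrite lerDr; apply: sumr_ge0 => i _; exact: ip_ge0.
- rewrite ipZl ipZr mulrA -expr2.
  have n2n : (n2 <= n.+1)%N by apply: leqW; apply: leq_trans mn'; rewrite /m; lia.
  have := H2 n.+1 n2n; rewrite /= /ediv.
  have [->|cn] := eqVneq (c n.+1) 0.
    by rewrite expr0n mul0r mulr_ge0 ?sqr_ge0.
  rewrite -EFinM lee_fin mulrA => r2C.
  have cp : 0 < c n.+1 by rewrite lt_neqAle eq_sym cn c_ge0.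
  move: r2C; rewrite ler_pdivlMr// => r2C.
  rewrite -dot_norm_sq -!exprMn ler_pXn2r ?nnegrE ?mulr_ge0 ?dot_norm_ge0 ?powR_ge0//.
  rewrite mulrC; apply: le_trans r2C _; apply: ler_wpM2r; first exact: powR_ge0.
  by apply: HkC; apply: leq_trans mM; rewrite /m; lia.
Qed.
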